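(* Let $\varphi$ be an Orlicz function satisfying the $\Delta_2^\infty$-condition, let $w_1,w_2$ be weight functions on $[0,1]$, and put $W_i(t)=\int_0^t w_i(s)\,ds$ for $i=1,2$. Then the following statements are equivalent: (i) $\lim_{t\to0^+}\frac{W_2(t)}{W_1(t)}=0$; (ii) the inclusion operator $J:\Lambda_{\varphi,w_1}[0,1]\to\Lambda_{\varphi,w_2}[0,1]$ is (well-defined and) disjointly strictly singular; (iii) there exist no sequence $(f_n)_{n=1}^\infty$ of nonzero pairwise disjoint functions (in $\Lambda_{\varphi,w_1}[0,1]\cap\Lambda_{\varphi,w_2}[0,1]$) and no constant $K>0$ such that $\|f_n\|_{\varphi,w_1}\le K\|f_n\|_{\varphi,w_2}$ for all $n\in\mathbb{N}$.
   Context: The interval $[0,1]$ carries Lebesgue measure $m$. $L_0$ is the space of real Lebesgue measurable functions on $[0,1]$ modulo a.e. equality. For $f\in L_0$, $d_f(\lambda)=m(\{t:|f(t)|>\lambda\})$ for $\lambda>0$, and $f^*(t)=\inf\{\lambda>0:d_f(\lambda)\le t\}$ for $t\ge0$ (with $\inf\varnothing=\infty$). An Orlicz function is a convex function $\varphi:[0,\infty)\to[0,\infty)$ with $\varphi(0)=0=\lim_{u\to0}\varphi(u)$ and $\varphi(u)>0$ for $u>0$ (put $\varphi(\infty)=\infty$). It satisfies the $\Delta_2^\infty$-condition if there are $K>2$ and $u_0\ge0$ with $\varphi(2u)\le K\varphi(u)$ for all $u\ge u_0$. A weight function on $[0,1]$ is a positive, decreasing (i.e. nonincreasing) integrable function $w:(0,1]\to(0,\infty)$.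 The modular is $\rho_{\varphi,w}(f)=\int_0^1\varphi(f^*(t))w(t)\,dt$. The Orlicz-Lorentz space is $\Lambda_{\varphi,w}[0,1]=\{f\in L_0:\rho_{\varphi,w}(kf)<\infty\text{ for some }k>0\}$, a Banach lattice under the Luxemburg norm $\|f\|_{\varphi,w}=\inf\{\varepsilon>0:\rho_{\varphi,w}(f/\varepsilon)\le1\}$. A sequence of functions $(x_n)$ is disjoint if $|x_n|\wedge|x_m|=0$ for $n\neq m$ (a.e. disjoint supports). A bounded linear operator $T:X\to Y$ from a Banach function lattice $X$ to a Banach space $Y$ is disjointly strictly singular (DSS) if for every disjoint sequence of non-null vectors $(x_n)_{n=1}^\infty\subset X$ the restriction of $T$ to $\overline{\mathrm{span}}\{x_n:n\in\mathbb{N}\}$ is not an isomorphism onto its image. *)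

(* Defs.v *)
From HB Require Import structures.
From mathcomp Require Import all_boot all_order all_algebra ring_quotient.
From mathcomp Require Import all_classical all_reals all_analysis.
From mathcomp Require Import measurable_realfun.

Set Implicit Arguments.
Unset Strict Implicit.
Unset Printing Implicit Defensive.
Import Order.TTheory GRing.Theory Num.Theory.
Import numFieldNormedType.Exports.

Local Open Scope classical_set_scope.
Local Open Scope ring_scope.
Local Open Scope quotient_scope.

Section L0.
Variable R : realType.

Local Notation m := (@completed_lebesgue_measure R).
Local Notation I01 := (`[0%R, 1%R]%classic : set R).

(* The domain is R with the sigma-algebra of Lebesgue measurable sets. *)
Local Notation lmfun :=
  {mfun caratheodory_type (wlength (@idfun R))^*%mu >-> R}.

Definition null01 : {pred lmfun} :=
  [pred f : lmfun | `[< ae_eq m I01 (f : R -> R) (cst 0) >]].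

Fact null01_zmod_closed : zmod_closed null01.
Proof.
split=> [|f g]; rewrite !inE; first exact: ae_eq_refl.
apply: filterS2 => t f0 g0 Dt /=.
by rewrite -[LHS]/(f t - g t) f0// g0// subr0.
Qed.

HB.instance Definition _ :=
  GRing.isZmodClosed.Build lmfun null01 null01_zmod_closed.

(* A measurable function on [0,1] is given by any measurable extension of it
   to the line (for instance by 0); two of them are identified when they agree
   almost everywhere on [0,1]. *)
Definition L0 : Type := {ideal_quot null01}.

HB.instance Definition _ := GRing.Zmodule.on L0.
HB.instance Definition _ := Quotient.on L0.

Definition L0_scale (a : R) (f : L0) : L0 := \pi_L0 (a *: repr f).

Lemma eq_L0P (f g : lmfun) :
  \pi_L0 f = \pi_L0 g <-> ae_eq m I01 (f : R -> R) (g : R -> R).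
Proof.
have -> : (\pi_L0 f = \pi_L0 g) <-> (f - g \in null01).
  by rewrite (Quotient.idealrBE null01); split=> /eqP.
rewrite inE; split; apply: filterS => t fg Dt /=.
  by apply/eqP; rewrite -subr_eq0; apply/eqP; exact: fg.
by rewrite -[LHS]/(f t - g t) fg// subrr.
Qed.

Lemma pi_L0_scale (a : R) (f : lmfun) : L0_scale a (\pi_L0 f) = \pi_L0 (a *: f).
Proof.
apply/eq_L0P; have /eq_L0P : \pi_L0 (repr (\pi_L0 f)) = \pi_L0 f by rewrite reprK.
by apply: filterS => t fE Dt /=; congr (a * _); exact: fE.
Qed.

Lemma pi_L0D (f g : lmfun) : \pi_L0 f + \pi_L0 g = \pi_L0 (f + g).
Proof. by apply/esym; exact: (Quotient.pi_add null01). Qed.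

Fact L0_scaleA a b (f : L0) :
  L0_scale a (L0_scale b f) = L0_scale (a * b) f.
Proof.
by elim/quotW: f => f; rewrite (pi_L0_scale b f) !pi_L0_scale scalerA.
Qed.

Fact L0_scale1 : left_id 1 L0_scale.
Proof. by elim/quotW => f; rewrite pi_L0_scale scale1r. Qed.

Fact L0_scaleDr : right_distributive L0_scale +%R.
Proof.
move=> a; elim/quotW => f; elim/quotW => g.
by rewrite pi_L0D !pi_L0_scale pi_L0D scalerDr.
Qed.

Fact L0_scaleDl (f : L0) : {morph L0_scale^~ f : a b / a + b}.
Proof.
by move=> a b; elim/quotW: f => f; rewrite !pi_L0_scale pi_L0D scalerDl.
Qed.

HB.instance Definition _ := GRing.Zmodule_isLmodule.Build R L0
  L0_scaleA L0_scale1 L0_scaleDr L0_scaleDl.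

(* An arbitrary representative; every notion defined from it below is invariant
   under a.e. equality on [0,1]. *)
Definition L0_fun (f : L0) : R -> R := (repr f : lmfun).

(* |f| /\ |g| = 0 *)
Definition L0_disjoint (f g : L0) : Prop :=
  ae_eq m I01 (fun t => Num.min `|L0_fun f t| `|L0_fun g t|) (cst 0).

Definition pairwise_disjoint (x : nat -> L0) : Prop :=
  forall i j, i <> j -> L0_disjoint (x i) (x j).

End L0.

Section operators.
Variable R : realType.

(* A subspace of an ambient vector space with its norm; the values of [nrm]
   outside of the subspace are irrelevant. *)
Record normed_subspace (U : lmodType R) := NormedSubspace {
  vectors :> U -> Prop ;
  nrm : U -> R }.

Definition sub_normed (U : lmodType R) (X : normed_subspace U) (A : set U) :=
  NormedSubspace (fun x => X x /\ A x) (nrm X).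

Definition bounded_linear_operator (U V : lmodType R)
    (X : normed_subspace U) (Y : normed_subspace V) (T : U -> V) : Prop :=
  [/\ forall x, X x -> Y (T x),
      forall a x y, X x -> X y -> T (a *: x + y) = a *: T x + T y &
      exists C : R, forall x, X x -> nrm Y (T x) <= C * nrm X x].

(* [S] is the inverse, which only matters on the image of [T]. *)
Definition isomorphism_onto_image (U V : lmodType R)
    (X : normed_subspace U) (Y : normed_subspace V) (T : U -> V) : Prop :=
  bounded_linear_operator X Y T /\
  exists S : V -> U,
    (forall x, X x -> S (T x) = x) /\
    bounded_linear_operator (sub_normed Y [set T x | x in vectors X]) X S.

Definition closed_span (U : lmodType R) (X : normed_subspace U)
    (x : nat -> U) : set U :=
  [set y | X y /\ forall e : R, 0 < e -> exists n (a : nat -> R),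
    nrm X (y - \sum_(i < n) a i *: x i) < e].

Definition disjointly_strictly_singular (V : lmodType R)
    (X : normed_subspace (L0 R)) (Y : normed_subspace V) (T : L0 R -> V) :=
  bounded_linear_operator X Y T /\
  forall x : nat -> L0 R, (forall n, X (x n)) -> (forall n, x n <> 0) ->
    pairwise_disjoint x ->
    ~ isomorphism_onto_image (sub_normed X (closed_span X x)) Y T.

End operators.

Section orlicz_lorentz.
Variable R : realType.

Local Notation m := (@completed_lebesgue_measure R).

Definition distribution_function (f : R -> R) (l : R) : \bar R :=
  m [set t | t \in `[0, 1] /\ l < `|f t|].

Definition decreasing_rearrangement (f : R -> R) (t : R) : \bar R :=
  ereal_inf [set l%:E | l in
    [set l : R | 0 < l /\ (distribution_function f l <= t%:E)%E]].

(* Only the values on [0, +oo[ matter. *)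
Definition orlicz_function (phi : R -> R) : Prop :=
  [/\ convex_function ([set u | 0 <= u] : set R^o) phi,
      phi 0 = 0,
      phi u @[u --> 0^'+] --> 0 &
      forall u, 0 < u -> 0 < phi u].

Definition Delta2_infty (phi : R -> R) : Prop :=
  exists K u0 : R, [/\ 2 < K, 0 <= u0 &
    forall u, u0 <= u -> phi (2 * u) <= K * phi u].

(* Only the values on ]0, 1] matter. *)
Definition weight_function (w : R -> R) : Prop :=
  [/\ forall t, t \in `]0, 1] -> 0 < w t,
      {in `]0, 1] &, {homo w : s t / s <= t >-> t <= s}} &
      m.-integrable `]0, 1] (EFin \o w)].

Definition weight_primitive (w : R -> R) (t : R) : R :=
  \int[m]_(s in `]0, t]) w s.

(* phi(+oo) = +oo *)
Definition orlicz_ext (phi : R -> R) (x : \bar R) : \bar R :=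
  if x is r%:E then (phi r)%:E else x.

Definition modular (phi w : R -> R) (f : L0 R) : \bar R :=
  (\int[m]_(t in `]0%R, 1%R])
    (orlicz_ext phi (decreasing_rearrangement (L0_fun f) t) * (w t)%:E))%E.

Definition luxemburg_norm (phi w : R -> R) (f : L0 R) : R :=
  inf [set e : R | 0 < e /\ (modular phi w (e^-1 *: f) <= 1)%E].

Definition orlicz_lorentz (phi w : R -> R) : normed_subspace (L0 R) :=
  NormedSubspace
    (fun f => exists k : R, 0 < k /\ (modular phi w (k *: f) < +oo)%E)
    (luxemburg_norm phi w).

End orlicz_lorentz.

(* Main.v *)
Require Import Defs.
From mathcomp Require Import all_boot all_order all_algebra.
From mathcomp Require Import all_classical all_reals all_analysis.
From mathcomp Require Import measurable_realfun lra ring.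

Set Implicit Arguments.
Unset Strict Implicit.
Unset Printing Implicit Defensive.
Import Order.TTheory GRing.Theory Num.Theory.
Import numFieldNormedType.Exports.
Local Open Scope classical_set_scope.
Local Open Scope ring_scope.

(** Write W1, W2 for the primitives of the weights, rho1, rho2 for the two
    modulars and D_f(l) for the measure of the set where |f| > l.

    The proof rests on the layer-cake formula [layer_cake]:

      rho_w(f) = int_0^oo W (D_f (psi s)) ds,

    where psi is the generalized inverse of phi.  The modular therefore sees f
    only through its distribution function and w only through its primitive,
    and an inequality between values of primitives at distribution functions,
    level by level, integrates to an inequality between modulars
    ([modular_le]).  It is used in four ways.

    - W is subadditive because w is nonincreasing, and |f + g| / 2 > l forces
      |f| > l or |g| > l; hence rho((f + g) / 2) <= rho(f) + rho(g), and the
      Luxemburg norm satisfies ||f + g|| <= 4 max(||f||, ||g||).  This weak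
      triangle inequality suffices below.
    - If W2 / W1 tends to 0 at 0+ then W2 <= C W1 on [0, 1], so the inclusion
      is well defined and bounded ([luxemburg_norm_domination]).
    - If moreover D_f(0) <= d and W2 <= e W1 on [0, d], then
      rho2(f) <= e rho1(f).  In a sequence of disjoint functions some f has
      such a small support.  Should ||f||_1 <= K ||f||_2 hold, the Delta2
      condition would bound rho1(2 f / ||f||_2) by a constant that depends only
      on K, phi and w1, whence rho2(2 f / ||f||_2) <= 1 for e small enough, that
      is, ||f||_2 <= ||f||_2 / 2: a contradiction
      ([limit_zero_no_comparable]).  An isomorphism on the closed span of the
      sequence would give such a constant K, so the inclusion is disjointly
      strictly singular.
    - If W2 / W1 does not tend to 0, there are e > 0 and points s_n with
      s_(n+1) <= s_n / 2 and e W1(s_n) <= W2(s_n).  Let x_n be the indicator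
      of ]s_(n+1), s_n].  For a combination y of the x_n and a level l, let i
      be the first index whose coefficient exceeds l in absolute value.  The
      set where |y| > l contains ]s_(i+1), s_i] and is contained in ]0, s_i],
      so its measure lies between s_i / 2 and s_i and
      W1(D_y(l)) <= (2 / e) W2(D_y(l))  ([step_sum_distr_comparison]).  Hence
      ||y||_1 <= C ||y||_2 on the linear span, which refutes the absence of
      comparable sequences.  When the inclusion is bounded, the estimate passes
      to the closed span by density and the weak triangle inequality
      ([span_domination]), so the inclusion is not disjointly strictly
      singular. *)

(** * Lebesgue measure on the completed sigma-algebra *)

Section lebesgue.
Variable R : realType.
Local Notation m := (@completed_lebesgue_measure R).
Local Notation cT := (caratheodory_type (wlength (@idfun R))^*%mu).

Lemma completed_lebesgue_itvoc (a b : R) :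
  a <= b -> m `]a, b]%classic = (b - a)%:E.
Proof.
move=> ab; rewrite -[LHS]/(@lebesgue_measure R `]a, b]%classic).
rewrite lebesgue_measure_itv /= lte_fin.
by case: ltgtP ab => // -> _; rewrite subrr.
Qed.

Lemma caratheodory_measurable_itv (i : interval R) :
  measurable ([set` i] : set cT).
Proof. by apply: sub_caratheodory; exact: measurable_itv. Qed.

Lemma le_measure_ae (A B : set cT) : measurable A -> measurable B ->
  (\forall t \ae m, A t -> B t) -> (m A <= m B)%E.
Proof.
move=> mA mB [N [mN N0 sN]].
apply: (@le_trans _ _ (m (B `|` N))).
  apply: le_measure; rewrite ?inE//; first exact: measurableU.
  move=> t At; have [Bt|nBt] := pselect (B t); [by left|].
  by right; apply: sN => /= /(_ At).
apply: (@le_trans _ _ (m B + m N)%E); first exact: measureU2.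
by rewrite [X in (_ + X)%E]N0 adde0.
Qed.

Lemma integrable_cst_itvoc (c a b : R) :
  m.-integrable (`]a, b] : set cT) (EFin \o cst c).
Proof.
apply: measurable_bounded_integrable.
- exact: caratheodory_measurable_itv.
- rewrite -[X in (X < _)%E]/(@lebesgue_measure R `]a, b]%classic).
  by rewrite lebesgue_measure_itv /=; case: ifP; rewrite ltry.
- exact: measurable_cst.
- exact: bounded_cst.
Qed.

Lemma Rintegral_cst_itvoc (c a b : R) : a <= b ->
  \int[m]_(s in `]a, b]) c = (b - a) * c.
Proof.
move=> ab; have mab := caratheodory_measurable_itv `]a, b].
have := @Rintegral_cst _ cT R m _ mab c; rewrite /Rintegral => ->.
by rewrite [X in fine X]completed_lebesgue_itvoc//= mulrC.
Qed.

End lebesgue.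

(** * Orlicz functions *)
Section orlicz_function.
Variables (R : realType) (phi : R -> R).
Hypothesis hphi : orlicz_function phi.

Lemma orlicz_convex (t x y : R) : 0 <= t <= 1 -> 0 <= x -> 0 <= y ->
  phi (t * x + (1 - t) * y) <= t * phi x + (1 - t) * phi y.
Proof.
move=> t01 x0 y0; case: hphi => cvx _ _ _.
have := cvx (@Itv01 R t (andP t01).1 (andP t01).2) x y.
by apply; rewrite inE.
Qed.

Lemma orlicz_scale (t x : R) : 0 <= t <= 1 -> 0 <= x ->
  phi (t * x) <= t * phi x.
Proof.
move=> t01 x0; have := orlicz_convex t01 x0 (lexx 0).
by have [_ -> _ _] := hphi; rewrite !mulr0 !addr0.
Qed.

Lemma orlicz_ge0 x : 0 <= x -> 0 <= phi x.
Proof.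
rewrite le_eqVlt => /predU1P[<-|x0]; first by have [_ -> _ _] := hphi.
by have [_ _ _ /(_ _ x0)/ltW] := hphi.
Qed.

Lemma orlicz_nondecreasing x y : 0 <= x -> x <= y -> phi x <= phi y.
Proof.
move=> x0; rewrite le_eqVlt => /predU1P[->//|xy].
have y0 : 0 < y by lra.
have q01 : 0 <= x / y <= 1.
  by rewrite divr_ge0 ?(ltW y0)//= ler_pdivrMr// mul1r ltW.
have := orlicz_scale q01 (ltW y0); rewrite divfK ?gt_eqF// => /le_trans; apply.
by rewrite ger_pMl ?(andP q01).2//; have [_ _ _ ->] := hphi.
Qed.

(** Convexity gives left continuity: u is a convex combination of 2 u, with
    small weight, and of a point v < u. *)
Lemma orlicz_left_continuous u s : 0 < u ->
  (forall v, 0 <= v < u -> phi v <= s) -> phi u <= s.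
Proof.
move=> u0 vs; have s0 : 0 <= s.
  by apply: le_trans (vs 0 _); rewrite ?orlicz_ge0 ?lexx.
apply/ler_addgt0Pr => e e0.
have p2 : 0 < phi (2 * u) by have [_ _ _ ->//] := hphi; lra.
(* the weight of 2 u: at most 1/3 to leave room for v >= 0, and small enough
   for its contribution to stay below e *)
pose t := Num.min (1 / 3) (e / phi (2 * u)).
have t0 : 0 < t by rewrite lt_min !divr_gt0.
have t3 : t <= 1 / 3 by rewrite ge_min lexx.
have te : t * phi (2 * u) <= e.
  by rewrite -ler_pdivlMr// ge_min lexx orbT.
have t1 : 0 < 1 - t by lra.
pose v := (u - t * (2 * u)) / (1 - t).
have tu : t * u <= u / 3 by rewrite mulrC ler_pM2l//; lra.
have v0 : 0 <= v by rewrite divr_ge0//; nra.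
have vu : v < u by rewrite ltr_pdivrMr//; nra.
have vE : (1 - t) * v = u - t * (2 * u) by rewrite mulrC divfK ?gt_eqF.
have uE : u = t * (2 * u) + (1 - t) * v by lra.
rewrite [in phi u]uE; apply: le_trans (orlicz_convex _ _ _) _ => //; try lra.
have := vs _ (introT andP (conj v0 vu)) => pv.
rewrite addrC lerD//.
by apply: le_trans (ler_wpM2l (ltW t1) pv) _; nra.
Qed.

(** The level l is the supremum of the points where phi <= s; left continuity
    puts the supremum itself among them. *)
Lemma orlicz_inverse_exists (s : R) : 0 <= s ->
  exists l : R, 0 <= l /\ forall u, 0 <= u -> (s < phi u) = (l < u).
Proof.
rewrite le_eqVlt => /predU1P[<-|s0].
  exists 0; split => // u; rewrite le_eqVlt => /predU1P[<-|u0].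
    by have [_ -> _ _] := hphi; rewrite !ltxx.
  by rewrite u0; have [_ _ _ ->] := hphi.
have p1 : 0 < phi 1 by have [_ _ _ ->] := hphi.
pose A := [set u : R | 0 <= u /\ phi u <= s].
have Au u : A u -> u <= Num.max 1 (s / phi 1).
  move=> [u0 us]; rewrite le_max; case: leP => //= u1.
  rewrite ler_pdivlMr//; apply: le_trans us.
  have u01 : 0 < u by lra.
  have q01 : 0 <= u^-1 <= 1 by rewrite invr_ge0 u0 /= invf_le1// ltW.
  have := orlicz_scale q01 u0; rewrite mulVf ?gt_eqF// => pu.
  by rewrite -(ler_pM2l (x := u^-1)) ?invr_gt0// mulrA mulVf ?gt_eqF// mul1r.
have ubA : has_ubound A by exists (Num.max 1 (s / phi 1)) => u /Au.
pose u1 := Num.min 1 (s / phi 1).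
have u10 : 0 < u1 by rewrite lt_min ltr01 divr_gt0.
have Au1 : A u1.
  split; first exact: ltW.
  have q01 : 0 <= u1 <= 1 by rewrite (ltW u10) /= ge_min lexx.
  have := orlicz_scale q01 ler01; rewrite mulr1 => /le_trans; apply.
  by rewrite -ler_pdivlMr// ge_min lexx orbT.
have l0 : 0 < sup A by apply: lt_le_trans u10 _; exact: ub_le_sup.
exists (sup A); split => [|u u0]; first exact: ltW.
apply/idP/idP => [su|lu]; last first.
  rewrite ltNge; apply/negP => us.
  by move: lu; rewrite ltNge ub_le_sup.
rewrite ltNge; apply/negP => ul.
have : phi (sup A) <= s.
  apply: orlicz_left_continuous => // v /andP[v0 vA].
  have [x [x0 xs] /ltW vx] := sup_gt (ex_intro _ _ Au1) vA.
  exact: le_trans (orlicz_nondecreasing v0 vx) xs.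
by move=> /(le_trans (orlicz_nondecreasing u0 ul)); rewrite leNgt su.
Qed.

(** Negative s are sent to the inverse at 0, so that psi is monotone on the
    whole line and its compositions with monotone functions are measurable
    there. *)
Lemma orlicz_inverse : exists psi : R -> R, [/\ forall s, 0 <= psi s,
  {homo psi : s t / s <= t} &
  forall s u, 0 <= s -> 0 <= u -> (s < phi u) = (psi s < u)].
Proof.
have ex s : exists l : R, 0 <= l /\
    forall u, 0 <= u -> (Num.max 0 s < phi u) = (l < u).
  by apply: orlicz_inverse_exists; rewrite le_max lexx.
have [psi psiP] := choice ex; exists psi; split => [s|s t st|s u s0 u0].
- by have [] := psiP s.
- have [ps0 psE] := psiP s; have [_ ptE] := psiP t.
  have := psE _ ps0; have := ptE _ ps0; rewrite ltxx => tE sE.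
  rewrite leNgt -tE; apply/negP => /(le_lt_trans _) => /(_ (Num.max 0 s)).
  rewrite sE => /(_ _)/notF; apply.
  by rewrite ge_max le_max lexx /= le_max st orbT.
- by have [_ <-] := psiP s; rewrite ?max_r.
Qed.

(** The additive constant absorbs the values below the threshold u0, where the
    doubling condition says nothing. *)
Lemma Delta2_affine : Delta2_infty phi ->
  exists K C : R, [/\ 0 < K, 0 <= C &
    forall u, 0 <= u -> phi (2 * u) <= K * phi u + C].
Proof.
move=> [K [u0 [K2 u00 hK]]]; exists K, (phi (2 * u0)).
split; [lra|by apply: orlicz_ge0; lra|] => u u_ge0.
have [u0u|uu0] := leP u0 u.
  by apply: le_trans (hK _ u0u) _; rewrite lerDl orlicz_ge0//; lra.
have : phi (2 * u) <= phi (2 * u0) by apply: orlicz_nondecreasing; lra.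
have := orlicz_ge0 u_ge0; nra.
Qed.

End orlicz_function.

(** * Weights and their primitives *)
Section weight.
Variables (R : realType) (w : R -> R).
Hypothesis hw : weight_function w.
Local Notation m := (@completed_lebesgue_measure R).
Local Notation cT := (caratheodory_type (wlength (@idfun R))^*%mu).
Local Notation W := (weight_primitive w).
Local Notation mitv := caratheodory_measurable_itv.

Lemma weight_gt0 t : 0 < t <= 1 -> 0 < w t.
Proof. by move=> t01; have [+ _ _] := hw; apply; rewrite in_itv. Qed.

Lemma weight_nonincreasing s t : 0 < s -> s <= t -> t <= 1 -> w t <= w s.
Proof.
by move=> s0 st t1; have [_ + _] := hw; apply => //; rewrite in_itv/=; lra.
Qed.

Lemma weight_integrable a b : 0 <= a -> b <= 1 ->
  m.-integrable `]a, b] (EFin \o w).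
Proof.
move=> a0 b1; have [_ _] := hw; apply: integrableS; try exact: mitv.
by move=> t /=; rewrite !in_itv/=; lra.
Qed.

Lemma measurable_weight : measurable_fun (`]0, 1] : set cT) w.
Proof. by have [_ _ /integrableP[/measurable_EFinP]] := hw. Qed.

Lemma weight_primitive0 : W 0 = 0.
Proof. by rewrite /weight_primitive set_itvoc0 Rintegral_set0. Qed.

Lemma Rintegral_weight_le a b : 0 < a -> a <= b -> b <= 1 ->
  \int[m]_(s in `]a, b]) w s <= (b - a) * w a.
Proof.
move=> a0 ab b1.
rewrite -Rintegral_cst_itvoc//.
apply: le_Rintegral; first exact: mitv.
- by apply: weight_integrable => //; exact: ltW.
- exact: integrable_cst_itvoc.
- by move=> t /=; rewrite in_itv/= => ?; apply: weight_nonincreasing; lra.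
Qed.

Lemma weight_primitive_ge t : 0 < t <= 1 -> t * w t <= W t.
Proof.
move=> /andP[t0 t1].
have -> : t * w t = \int[m]_(s in `]0, t]) w t.
  by rewrite Rintegral_cst_itvoc ?subr0// ltW.
apply: le_Rintegral; first exact: mitv.
- exact: integrable_cst_itvoc.
- exact: weight_integrable.
- by move=> s /=; rewrite in_itv/= => ?; apply: weight_nonincreasing; lra.
Qed.

Lemma weight_primitive_gt0 t : 0 < t <= 1 -> 0 < W t.
Proof.
move=> t01; apply: lt_le_trans (weight_primitive_ge t01).
by rewrite mulr_gt0 ?weight_gt0//; lra.
Qed.

Lemma weight_primitive_split x z : 0 <= x -> x <= z -> z <= 1 ->
  W z = W x + \int[m]_(s in `]x, z]) w s.
Proof.
move=> x0 xz z1; rewrite /weight_primitive.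
rewrite -Rintegral_setU //; try exact: mitv.
- congr (Rintegral _ _ _); apply/seteqP; split => t /=; rewrite !in_itv/=.
    by case: (leP t x); [left|right]; lra.
  by case; lra.
- have := weight_integrable (lexx 0) z1.
  apply: integrableS; try exact: mitv.
    by apply: measurableU; exact: mitv.
  by move=> t /=; rewrite !in_itv/=; case; lra.
- by apply/disj_setPS => t /= []; rewrite !in_itv/=; lra.
Qed.

Lemma weight_primitive_le x z : 0 <= x -> x <= z -> z <= 1 -> W x <= W z.
Proof.
move=> x0 xz z1; rewrite (weight_primitive_split x0 xz z1) lerDl.
apply: Rintegral_ge0 => t /=; rewrite in_itv/= => ?.
by apply/ltW/weight_gt0; lra.
Qed.

(** Say y <= x.  On ]x, z], of length at most y, the weight is at most w x,
    hence at most w y, while y * w y <= W y. The shape with z <= x + y avoids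
    values of W beyond 1, where w is arbitrary. *)
Lemma weight_primitive_subadditive x y z : 0 <= x <= 1 -> 0 <= y <= 1 ->
  0 <= z <= 1 -> z <= x + y -> W z <= W x + W y.
Proof.
wlog : x y / y <= x => [hwlog x01 y01 z01 zxy|yx x01 y01 z01 zxy].
  have [/hwlog|/ltW/hwlog h] := leP y x; first exact.
  by rewrite addrC; apply: h => //; rewrite addrC.
have [y0|y0] := eqVneq y 0.
  by rewrite y0 weight_primitive0 addr0; apply: weight_primitive_le; lra.
have {}y0 : 0 < y by rewrite lt_neqAle eq_sym y0; lra.
have [zx|/ltW xz] := leP z x.
  apply: (@le_trans _ _ (W x)); first by apply: weight_primitive_le; lra.
  by rewrite lerDl ltW// weight_primitive_gt0//; lra.
rewrite (@weight_primitive_split x z)//; try lra.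
rewrite lerD2l; apply: le_trans (Rintegral_weight_le _ _ _) _; try lra.
apply: le_trans (weight_primitive_ge _); last lra.
apply: ler_pM; try lra; first by apply/ltW/weight_gt0; lra.
by apply: weight_nonincreasing; lra.
Qed.

Lemma weight_primitive_ge0 x : 0 <= x <= 1 -> 0 <= W x.
Proof.
by move=> ?; rewrite -weight_primitive0; apply: weight_primitive_le; lra.
Qed.

(** The open interval is the one on which the rearrangement exceeds a level. *)
Lemma weight_primitive_itvoo x : 0 <= x <= 1 ->
  (\int[m]_(t in `]0%R, x[) (w t)%:E = (W x)%:E)%E.
Proof.
move=> x01.
have iw : m.-integrable `]0, x] (EFin \o w).
  by apply: weight_integrable; lra.
rewrite /weight_primitive fineK; last first.
  by apply: integrable_fin_num iw; exact: mitv.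
have mx : measurable ([set x] : set cT).
  by apply: sub_caratheodory; exact: measurable_set1.
have -> : `]0, x[%classic = `]0, x]%classic `\` [set x].
  apply/seteqP; split => t /=; rewrite !in_itv/=.
    by move=> tx; split; [lra|move=> tE; lra].
  by move=> [/andP[-> tx] /eqP tE]; rewrite lt_neqAle tE tx.
apply/esym; apply: (@ge0_negligible_integral _ cT _ m) => /=.
- exact: mx.
- exact: mitv.
- by case/integrableP: iw.
- by move=> t /=; rewrite in_itv/= => ?; rewrite lee_fin ltW// weight_gt0; lra.
- rewrite -[LHS]/(@lebesgue_measure R [set x]); exact: lebesgue_measure_set1.
Qed.

End weight.

(** * Decreasing rearrangement *)

Section rearrangement.
Variable R : realType.
Local Notation m := (@completed_lebesgue_measure R).
Local Notation cT := (caratheodory_type (wlength (@idfun R))^*%mu).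
Local Notation d := distribution_function.
Local Notation mitv := caratheodory_measurable_itv.
Variable f : {mfun cT >-> R}.

Lemma measurable_superlevel (l : R) :
  measurable ([set t | t \in `[0, 1] /\ l < `|f t|] : set cT).
Proof.
have -> : [set t | t \in `[0, 1] /\ l < `|f t|] =
    `[0, 1] `&` (Num.norm \o f) @^-1` `]l, +oo[.
  by apply/seteqP; split => t /=; rewrite !in_itv/= andbT.
have mnf : measurable_fun (setT : set cT) (Num.norm \o f).
  exact: measurableT_comp.
apply: measurableI; first exact: mitv.
by rewrite -[X in measurable X]setTI; apply: mnf => //; exact: measurable_itv.
Qed.

Lemma distribution_function_ge0 l : (0 <= d f l)%E.
Proof. exact: measure_ge0. Qed.

Lemma distribution_function_le1 l : (d f l <= 1)%E.
Proof.
apply: (@le_trans _ _ (m `[0, 1]%classic)).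
  apply: le_measure; rewrite ?inE; last by move=> t [].
  - exact: measurable_superlevel.
  - exact: mitv.
rewrite -[X in (X <= _)%E]/(@lebesgue_measure R `[0, 1]%classic).
by rewrite lebesgue_measure_itv /= lte_fin ltr01 sube0.
Qed.

Lemma distribution_function_fineK l : (fine (d f l))%:E = d f l.
Proof.
rewrite fineK// ge0_fin_numE ?distribution_function_ge0//.
by apply: le_lt_trans (distribution_function_le1 l) _; rewrite ltry.
Qed.

Lemma distribution_function_nonincreasing l l' :
  l <= l' -> (d f l' <= d f l)%E.
Proof.
move=> ll'; apply: le_measure; rewrite ?inE;
  try exact: measurable_superlevel.
by move=> t [t01 lt]; split => //; exact: le_lt_trans lt.
Qed.

(** Right continuity of the distribution function, by continuity of the measure
    along the increasing union of the level sets at l + 1 / (n + 1). *)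
Lemma distribution_function_right (l : R) (t : \bar R) : (t < d f l)%E ->
  exists2 l', l < l' & (t < d f l')%E.
Proof.
move=> tl; apply: contrapT => h.
pose F (n : nat) := [set t : cT | t \in `[0%R, 1%R] /\ l + n.+1%:R^-1 < `|f t|].
have UF : \bigcup_n F n = [set t | t \in `[0, 1] /\ l < `|f t|].
  apply/seteqP; split => [x [n _ [x01 lx]]|x [x01 lx]].
    by split => //; apply: lt_trans lx; rewrite ltrDl invr_gt0.
  have : 0 < `|f x| - l by rewrite subr_gt0.
  move=> /(@ltr_add_invr R 0)[k]; rewrite add0r => kx.
  by exists k => //; split => //; rewrite -ltrBrDl.
have mF n : measurable (F n) by exact: measurable_superlevel.
have : m \o F @ \oo --> m (\bigcup_n F n).
  apply: nondecreasing_cvg_mu => //.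
    by rewrite UF; exact: measurable_superlevel.
  move=> i j ij; apply/subsetPset => x [x01 lx]; split => //.
  apply: le_lt_trans lx; rewrite lerD2l lef_pV2 ?posrE//.
  by rewrite ler_nat.
rewrite UF => cvgF.
have : (m [set t | t \in `[0%R, 1%R] /\ (l < `|f t|)%R] <= t)%E.
  rewrite -(cvg_lim _ cvgF)//; apply: lime_le.
    by apply/cvg_ex; eexists; exact: cvgF.
  apply: nearW => n; rewrite leNgt; apply/negP => tF.
  by apply: h; exists (l + n.+1%:R^-1) => //; rewrite ltrDl invr_gt0.
by rewrite leNgt tl.
Qed.

Lemma decreasing_rearrangement_ge0 t : (0 <= decreasing_rearrangement f t)%E.
Proof. by apply: le_ereal_inf_tmp => _ [l [l0 _] <-]; rewrite lee_fin ltW. Qed.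

(** The rearrangement and the distribution function are inverse to each other
    in the sense of a Galois connection; right continuity of the latter is what
    makes the strict inequalities equivalent. *)
Lemma lt_decreasing_rearrangement l t : 0 <= l ->
  (l%:E < decreasing_rearrangement f t)%E = (t%:E < d f l)%E.
Proof.
move=> l0; apply/idP/idP => [lt|].
  rewrite ltNge; apply/negP => dt; move: lt; rewrite ltNge => /negP; apply.
  apply/lee_addgt0Pr => e e0; apply: ereal_inf_lbound => /=.
  exists (l + e) => //; split; first by lra.
  by apply: le_trans dt; apply: distribution_function_nonincreasing; lra.
move=> /distribution_function_right[l' ll' tl'].
apply: (@lt_le_trans _ _ l'%:E); first by rewrite lte_fin.
apply: le_ereal_inf_tmp => _ [k [k0 dk] <-]; rewrite lee_fin leNgt.
apply/negP => /ltW/distribution_function_nonincreasing/(lt_le_trans tl').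
by rewrite ltNge dk.
Qed.

End rearrangement.

(** * The layer-cake formula *)

Lemma lebesgue_measure_below (R : realType) (g : \bar R) : (0 <= g)%E ->
  @lebesgue_measure R [set s | 0 <= s /\ (s%:E < g)%E] = g.
Proof.
case: g => [g|_|//].
  rewrite lee_fin => g0.
  have -> : [set s | 0 <= s /\ (s%:E < g%:E)%E] = `[0, g[%classic.
    by apply/seteqP; split => s /=; rewrite in_itv/= lte_fin => /andP.
  rewrite lebesgue_measure_itv/= lte_fin sube0; case: ifPn => //.
  by rewrite -leNgt => ?; congr EFin; lra.
have -> : [set s : R | 0 <= s /\ (s%:E < +oo)%E] = `[0, +oo[%classic.
  by apply/seteqP; split => s /=; rewrite in_itv/= andbT ltry// => -[].
by rewrite lebesgue_measure_itv/= ltry.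
Qed.

Section layer_cake.
Variable R : realType.
Local Notation m := (@completed_lebesgue_measure R).
Local Notation cT := (caratheodory_type (wlength (@idfun R))^*%mu).
Local Notation d := distribution_function.
Local Notation mitv := caratheodory_measurable_itv.
Local Notation leb := (@lebesgue_measure R).
Variables (phi psi w : R -> R).
Hypothesis hphi : orlicz_function phi.
Hypothesis psi0 : forall s, 0 <= psi s.
Hypothesis psi_homo : {homo psi : s t / s <= t}.
Hypothesis psiE : forall s u, 0 <= s -> 0 <= u -> (s < phi u) = (psi s < u).
Hypothesis hw : weight_function w.
Variable f : {mfun cT >-> R}.
Local Notation W := (weight_primitive w).

Lemma lt_orlicz_ext s (x : \bar R) : 0 <= s -> (0 <= x)%E ->
  (s%:E < orlicz_ext phi x)%E = ((psi s)%:E < x)%E.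
Proof. by case: x => [u|//|//] s0 u0 /=; rewrite ?ltry// !lte_fin psiE. Qed.

Lemma orlicz_ext_ge0 (x : \bar R) : (0 <= x)%E -> (0 <= orlicz_ext phi x)%E.
Proof. by case: x => // u; rewrite !lee_fin; exact: orlicz_ge0. Qed.

Let D s := fine (d f (psi s)).

Let DE s : (D s)%:E = d f (psi s).
Proof. exact: distribution_function_fineK. Qed.

Let D01 s : 0 <= D s <= 1.
Proof.
by rewrite -!lee_fin DE distribution_function_ge0 distribution_function_le1.
Qed.

Let DP s t : 0 <= s ->
  (s%:E < orlicz_ext phi (decreasing_rearrangement f t))%E = (t < D s).
Proof.
move=> s0; rewrite lt_orlicz_ext ?decreasing_rearrangement_ge0//.
by rewrite lt_decreasing_rearrangement// -DE lte_fin.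
Qed.

Let measurable_D : @measurable_fun _ _ (measurableTypeR R) _ setT D.
Proof.
apply: nonincreasing_measurable => //= s t st.
rewrite -lee_fin !DE; apply: distribution_function_nonincreasing.
exact: psi_homo.
Qed.

Let A := [set p : cT * measurableTypeR R |
  [/\ 0 <= p.2, p.1 \in `]0, 1] & p.1 < D p.2]].

Let measurable_id : @measurable_fun _ _ cT (measurableTypeR R) setT id.
Proof. by move=> _ Y mY; rewrite setTI; exact: sub_caratheodory. Qed.

Let mfst : @measurable_fun _ _ (cT * measurableTypeR R)%type
  (measurableTypeR R) setT fst.
Proof. exact: (measurableT_comp measurable_id measurable_fst). Qed.

Let mA : measurable A.
Proof.
pose B1 (p : cT * measurableTypeR R) : bool := 0 <= p.2.
pose B2 (p : cT * measurableTypeR R) : bool := (0:R) < p.1.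
pose B3 (p : cT * measurableTypeR R) : bool := p.1 <= (1:R).
pose B4 (p : cT * measurableTypeR R) : bool := (p.1:R) < D p.2.
have -> : A = B1 @^-1` [set true] `&` (B2 @^-1` [set true] `&`
   (B3 @^-1` [set true] `&` B4 @^-1` [set true])).
  apply/seteqP; split => p; rewrite /A/B1/B2/B3/B4/= in_itv/=.
    by move=> [-> /andP[-> ->] ->].
  by move=> [-> [-> [-> ->]]].
have h (B : (cT * measurableTypeR R)%type -> bool) : measurable_fun setT B ->
    measurable (B @^-1` [set true]).
  by move=> /(_ measurableT [set true]); rewrite setTI; exact.
apply: measurableI; [|apply: measurableI; [|apply: measurableI]]; apply: h.
- exact: measurable_fun_ler.
- exact: measurable_fun_ltr.
- exact: measurable_fun_ler.
- apply: measurable_fun_ltr => //; exact: measurableT_comp.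
Qed.

Let w1 : R -> R := w \_ `]0, 1].

Let w1_ge0 t : 0 <= w1 t.
Proof.
rewrite /w1 patchE; case: ifPn => //; rewrite inE/= in_itv/= => t01.
exact/ltW/(weight_gt0 hw).
Qed.

Let mw1 : measurable_fun (setT : set cT) w1.
Proof.
apply/(measurable_restrictT _ _).1 => //; first exact: mitv.
exact: measurable_weight.
Qed.

Let F (p : cT * measurableTypeR R) : \bar R := (\1_A p * w1 p.1)%:E.

Let F_ge0 p : (0 <= F p)%E.
Proof. by rewrite lee_fin mulr_ge0. Qed.

Let mF : measurable_fun setT F.
Proof.
apply/measurable_EFinP; apply: measurable_funM; first exact: measurable_indic.
exact: measurableT_comp.
Qed.

Let int_level (t : R) : t \in `]0, 1] ->
  (\int[leb]_s F (t, s) =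
   orlicz_ext phi (decreasing_rearrangement f t) * (w t)%:E)%E.
Proof.
move=> t01; set G := orlicz_ext _ _.
pose B := [set s : measurableTypeR R | 0 <= s /\ (s%:E < G)%E].
have BE : B = [set s | A (t, s)].
  apply/seteqP; split => s; rewrite /A /B /=.
    by move=> [s0]; rewrite DP.
  by move=> [s0 _]; rewrite DP.
have mB : measurable B.
  rewrite BE (_ : [set s | A (t, s)] = xsection A t).
    exact: measurable_xsection.
  by apply/seteqP; split => s; rewrite /xsection/= inE.
have lB : leb B = G.
  apply: lebesgue_measure_below.
  exact/orlicz_ext_ge0/decreasing_rearrangement_ge0.
transitivity (\int[leb]_s ((w t)%:E * (\1_B s)%:E))%E.
  apply: eq_integral => s _; rewrite /F /w1 patchE mem_set//= BE mulrC EFinM.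
  by congr (_ * (_)%:E)%E; rewrite !indicE; congr (nat_of_bool _)%:R;
    apply/idP/idP; rewrite !inE.
rewrite ge0_integralZl//.
- by rewrite integral_indic// setIT muleC; congr (_ * _)%E; exact: lB.
- by apply/measurable_EFinP; exact: measurable_indic.
- by rewrite lee_fin ltW// (weight_gt0 hw); rewrite in_itv in t01.
Qed.

Let int_time (s : R) : (\int[m]_t F (t, s) =
  (if (0 <= s)%R then (W (D s))%:E else 0))%E.
Proof.
case: ifPn => s0; last first.
  rewrite (eq_integral (cst 0)) ?integral0// => t _.
  by rewrite /F indicE memNset ?mul0r// => -[/=]; rewrite (negbTE s0).
rewrite -(weight_primitive_itvoo hw)// [RHS]integral_mkcond.
apply: eq_integral => t _; rewrite /F indicE /w1 !patchE.
have [tA|tA] := pselect (A (t, s)).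
  have [/= _ t01 tD] := tA; rewrite (mem_set tA) mul1r !mem_set//=.
  by move: t01; rewrite !in_itv/=; lra.
rewrite (memNset tA) mul0r memNset//= in_itv/= => /andP[t0 tD].
apply: tA; split => //=; rewrite in_itv/= t0 (le_trans (ltW tD))//.
by have /andP[] := D01 s.
Qed.

(** Both sides are iterated integrals of (t, s) |-> w t over the set of points
    with s < phi (f^* t), that is, with t < D_f (psi s).  For fixed t the
    section in s has length phi (f^* t); for fixed s the integral in t is
    W (D_f (psi s)). *)
Lemma layer_cake :
  (\int[m]_(t in `]0%R, 1%R])
    (orlicz_ext phi (decreasing_rearrangement f t) * (w t)%:E) =
  \int[leb]_(s in `[0%R, +oo[) (W (fine (d f (psi s))))%:E)%E.
Proof.
transitivity (\int[m]_t \int[leb]_s F (t, s))%E.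
  rewrite integral_mkcond; apply: eq_integral => t _; rewrite patchE.
  case: ifPn => [/set_mem t01|t01]; first by rewrite int_level.
  rewrite (eq_integral (cst 0)%E) ?integral0// => s _.
  by rewrite /F /w1/= patchE (negbTE t01) mulr0.
rewrite (fubini_tonelli F)// [RHS]integral_mkcond.
apply: eq_integral => s _; rewrite int_time patchE; case: ifPn => s0.
  by rewrite mem_set//= in_itv/= andbT.
by rewrite memNset//= in_itv/= andbT (negbTE s0).
Qed.

Lemma measurable_layer :
  measurable_fun (`[0, +oo[ : set (measurableTypeR R))
    (fun s => (W (fine (d f (psi s))))%:E).
Proof.
apply/measurable_EFinP; apply: nonincreasing_measurable.
  exact: measurable_itv.
move=> s t st; apply: (weight_primitive_le hw).
- by have /andP[] := D01 t.
- rewrite -lee_fin !DE; apply: distribution_function_nonincreasing.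
  exact: psi_homo.
- by have /andP[] := D01 s.
Qed.

Lemma measurable_modular_integrand : measurable_fun (`]0, 1] : set cT)
  (fun t => orlicz_ext phi (decreasing_rearrangement f t) * (w t)%:E)%E.
Proof.
apply: emeasurable_funM; last first.
  by apply/measurable_EFinP; exact: measurable_weight.
move=> mI; apply: (measurability _ (ErealGenOInfty.measurableE R)) => //.
move=> _ [_ [s ->] <-]; have [s0|s0] := leP 0 s; last first.
  rewrite setIidl// => t _ /=; rewrite in_itv/= andbT.
  apply: lt_le_trans (orlicz_ext_ge0 (decreasing_rearrangement_ge0 f t)).
  by rewrite lte_fin.
have -> : (fun t => orlicz_ext phi (decreasing_rearrangement f t)) @^-1`
    `]s%:E, +oo[%classic = `]-oo, D s[%classic.
  by apply/seteqP; split => t /=; rewrite !in_itv/= andbT DP.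
by apply: measurableI => //; exact: mitv.
Qed.

End layer_cake.

(** * Distribution functions of classes of functions *)

Section L0_distribution.
Local Open Scope quotient_scope.
Variable R : realType.
Local Notation m := (@completed_lebesgue_measure R).
Local Notation cT := (caratheodory_type (wlength (@idfun R))^*%mu).
Local Notation I01 := (`[0%R, 1%R]%classic : set R).
Local Notation lmfun := {mfun cT >-> R}.
Implicit Types f g : L0 R.

Definition distr f (l : R) : R := fine (distribution_function (L0_fun f) l).

Lemma distrE f l : (distr f l)%:E = distribution_function (L0_fun f) l.
Proof. exact: (distribution_function_fineK (repr f)). Qed.

Lemma distr_itv f l : 0 <= distr f l <= 1.
Proof.
rewrite -!lee_fin distrE (distribution_function_ge0 (repr f)).
exact: (distribution_function_le1 (repr f)).
Qed.

Lemma distr_nonincreasing f l l' : l <= l' -> distr f l' <= distr f l.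
Proof.
move=> ll'; rewrite -lee_fin !distrE.
exact: (distribution_function_nonincreasing (repr f)).
Qed.

(** The chosen representative agrees a.e. on [0, 1] with the function that
    defines the class; the computations below go through this. *)
Lemma L0_fun_pi (f : lmfun) : ae_eq m I01 (L0_fun (\pi_(L0 R) f)) f.
Proof. by apply/eq_L0P; rewrite reprK. Qed.

Lemma L0_funK f : \pi_(L0 R) (repr f : lmfun) = f.
Proof. exact: reprK. Qed.

Lemma L0_fun_scale a f :
  ae_eq m I01 (L0_fun (a *: f)) (fun t => a * L0_fun f t).
Proof. exact: L0_fun_pi. Qed.

Lemma L0_fun_add f g :
  ae_eq m I01 (L0_fun (f + g)) (fun t => L0_fun f t + L0_fun g t).
Proof.
rewrite -[in L0_fun (f + g)](L0_funK f) -[in L0_fun (_ + g)](L0_funK g) pi_L0D.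
exact: L0_fun_pi.
Qed.

Lemma L0_fun0 : ae_eq m I01 (L0_fun (0 : L0 R)) (cst 0).
Proof.
have := L0_fun_scale 0 0; rewrite scale0r.
by apply: filterS => t h It; rewrite h// mul0r.
Qed.

Lemma L0_eq0P f : ae_eq m I01 (L0_fun f) (cst 0) -> f = 0.
Proof.
move=> f0; rewrite -(L0_funK f) -[RHS]L0_funK; apply/eq_L0P.
by apply: filterS2 f0 L0_fun0 => t f0 z0 It; rewrite [LHS]f0// [RHS]z0.
Qed.

Lemma measurable_L0_superlevel f l :
  measurable ([set t | t \in `[0, 1] /\ l < `|L0_fun f t|] : set cT).
Proof. exact: measurable_superlevel (repr f) l. Qed.

Lemma distr_scale a f l : a != 0 -> distr (a *: f) l = distr f (l / `|a|).
Proof.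
move=> a0; have a0' : 0 < `|a| by rewrite normr_gt0.
rewrite /distr; congr fine; apply/eqP; rewrite eq_le.
apply/andP; split; apply: le_measure_ae; try exact: measurable_L0_superlevel.
  apply: filterS (L0_fun_scale a f) => t ft /= [t01 lt]; split => //.
  by rewrite ltr_pdivrMr// mulrC -normrM -ft.
apply: filterS (L0_fun_scale a f) => t ft /= [t01 lt]; split => //.
by rewrite ft// normrM mulrC -ltr_pdivrMr.
Qed.

Lemma distr_opp f l : distr (- f) l = distr f l.
Proof.
by rewrite -scaleN1r distr_scale ?oppr_eq0 ?oner_eq0// normrN1 divr1.
Qed.

(** The mean of two numbers of modulus at most l has modulus at most l. *)
Lemma distr_mean_le f g l :
  distr (2^-1 *: (f + g)) l <= distr f l + distr g l.
Proof.
rewrite -lee_fin EFinD !distrE.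
apply: le_trans (measureU2 _ _ _); try exact: measurable_L0_superlevel.
apply: le_measure_ae; first exact: measurable_L0_superlevel.
  by apply: measurableU; exact: measurable_L0_superlevel.
apply: filterS2 (L0_fun_scale 2^-1 (f + g)) (L0_fun_add f g).
move=> t ft gt /= [t01 lt].
have [lf|fl] := ltP l `|L0_fun f t|; first by left.
right; split => //; rewrite ltNge; apply/negP => gl.
move: lt; rewrite ft// gt// normrM gtr0_norm ?invr_gt0// ltNge => /negP; apply.
by have := ler_normD (L0_fun f t) (L0_fun g t); lra.
Qed.

Lemma distr0 l : 0 <= l -> distr 0 l = 0.
Proof.
move=> l0; apply/eqP; rewrite eq_le (andP (distr_itv 0 l)).1 andbT.
rewrite -lee_fin distrE; apply: (@le_trans _ _ (m set0)); last first.
  by rewrite measure0.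
apply: le_measure_ae => //; first exact: measurable_L0_superlevel.
by apply: filterS L0_fun0 => t f0 /= [t01]; rewrite f0//= normr0; lra.
Qed.

(** Right continuity at level 0: a nonzero class exceeds some positive level on
    a set of positive measure. *)
Lemma distr_gt0 f : f <> 0 -> exists2 l, 0 < l & 0 < distr f l.
Proof.
move=> fn0; apply: contrapT => h; apply: fn0; apply: L0_eq0P.
have d0 : distribution_function (L0_fun f) 0 = 0%E.
  apply/eqP; rewrite eq_le -distrE lee_fin -[X in _ && X]lee_fin distrE.
  rewrite (distribution_function_ge0 (repr f)) andbT leNgt; apply/negP.
  rewrite -lte_fin distrE => /(distribution_function_right (f := repr f))[l l0].
  rewrite -[distribution_function _ _]distrE lte_fin => dl.
  by apply: h; exists l.
exists [set t | t \in `[0, 1] /\ 0 < `|L0_fun f t|]; split => //.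
  exact: measurable_L0_superlevel.
move=> t /= /not_implyP[t01 /eqP ft]; split => //.
by rewrite normr_gt0.
Qed.

End L0_distribution.

(** * Comparison of modulars *)

(** Compare h with its value at s on [0, s]. *)
Lemma nonincreasing_integral_ge (R : realType) (h : R -> R) (s : R) :
  (forall t, 0 <= h t) -> nonincreasing_fun h -> 0 <= s ->
  ((s * h s)%:E <= \int[@lebesgue_measure R]_(t in `[0%R, +oo[) (h t)%:E)%E.
Proof.
move=> h0 hni s0.
have mh (D : set (measurableTypeR R)) : measurable D ->
    measurable_fun D (fun t => (h t)%:E).
  by move=> mD; apply/measurable_EFinP; exact: nonincreasing_measurable.
have sub : `[0, s] `<=` (`[0, +oo[ : set R).
  by move=> t /=; rewrite !in_itv/= andbT => /andP[].
apply: (@le_trans _ _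
    (\int[@lebesgue_measure R]_(t in `[0%R, s]) (h t)%:E)%E); last first.
  have m0y : measurable (`[0%R, +oo[ : set (measurableTypeR R)).
    exact: measurable_itv.
  apply: (ge0_subset_integral _ _ _ (mh _ m0y) _ sub) => //.
  by move=> t _; rewrite lee_fin.
have -> : ((s * h s)%:E =
    \int[@lebesgue_measure R]_(t in `[0%R, s]) (h s)%:E)%E.
  rewrite integral_cst//= [X in (_ * X)%E](_ : _ = s%:E) ?EFinM 1?muleC//.
  rewrite lebesgue_measure_itv/= lte_fin sube0; case: ifPn => //.
  by rewrite -leNgt => ?; congr EFin; lra.
apply: ge0_le_integral => //.
- by move=> t _; rewrite lee_fin.
- exact: mh.
- by move=> t /=; rewrite in_itv/= => /andP[t0 ts]; rewrite lee_fin hni.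
Qed.

Lemma ge0_integral_le_lincomb d (T : measurableType d) (R : realType)
    (mu : {measure set T -> \bar R}) (E : set T) (u v1 v2 : T -> \bar R)
    (a1 a2 : R) : measurable E -> 0 <= a1 -> 0 <= a2 ->
  measurable_fun E u -> measurable_fun E v1 -> measurable_fun E v2 ->
  (forall t, E t -> (0 <= u t)%E) -> (forall t, E t -> (0 <= v1 t)%E) ->
  (forall t, E t -> (0 <= v2 t)%E) ->
  (forall t, E t -> (u t <= a1%:E * v1 t + a2%:E * v2 t)%E) ->
  (\int[mu]_(t in E) u t <=
   a1%:E * \int[mu]_(t in E) v1 t + a2%:E * \int[mu]_(t in E) v2 t)%E.
Proof.
move=> mE a10 a20 mu0 mv1 mv2 u0 v10 v20 h.
have Z (a : R) v : 0 <= a -> measurable_fun E v ->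
    (forall t, E t -> (0 <= v t)%E) ->
    measurable_fun E (fun t => a%:E * v t)%E /\
    (forall t, E t -> (0 <= a%:E * v t)%E).
  move=> a0 mv v0; split => [|t Et]; last by rewrite mule_ge0// v0.
  by apply: emeasurable_funM => //; exact: measurable_cst.
have [mZ1 Z1] := Z _ _ a10 mv1 v10; have [mZ2 Z2] := Z _ _ a20 mv2 v20.
rewrite -ge0_integralZl_EFin// -ge0_integralZl_EFin// -ge0_integralD//.
by apply: ge0_le_integral => //; exact: emeasurable_funD.
Qed.

Lemma ge0_ereal_eq_lt (R : realType) (x y : \bar R) :
  (0 <= x)%E -> (0 <= y)%E ->
  (forall l, 0 <= l -> (l%:E < x)%E = (l%:E < y)%E) -> x = y.
Proof.
wlog : x y / (x < y)%E => [hwlog x0 y0 h|xy x0 y0 h].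
  have [xy|yx|//] := ltgtP x y; first exact: hwlog.
  by apply/esym; apply: hwlog => // l l0; rewrite h.
case: x xy x0 h => [x xy x0 h|+ _ _|//].
  by have := h x x0; rewrite xy ltxx.
by rewrite ltNge leey.
Qed.

Section modular.
Variables (R : realType) (phi : R -> R).
Hypothesis hphi : orlicz_function phi.
Local Notation m := (@completed_lebesgue_measure R).
Local Notation cT := (caratheodory_type (wlength (@idfun R))^*%mu).
Local Notation rho := (modular phi).
Local Notation W := weight_primitive.
Local Notation mitv := caratheodory_measurable_itv.
Local Notation X := (orlicz_lorentz phi).
Implicit Types (f g : L0 R) (w : R -> R).

Lemma modular_ge0 w f : weight_function w -> (0 <= rho w f)%E.
Proof.
move=> hw; apply: integral_ge0 => t /=; rewrite in_itv/= => t01.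
apply: mule_ge0; last by rewrite lee_fin ltW// (weight_gt0 hw).
apply: (orlicz_ext_ge0 hphi).
exact: (decreasing_rearrangement_ge0 (repr f)).
Qed.

(** Integrate the hypothesis at the levels psi s with the layer-cake formula.
    Two modulars on the right cover both the domination of one weight by another
    and the near-subadditivity of a single modular. *)
Lemma modular_le w w1 w2 f f1 f2 (a1 a2 : R) : weight_function w ->
  weight_function w1 -> weight_function w2 -> 0 <= a1 -> 0 <= a2 ->
  (forall l, 0 <= l ->
    W w (distr f l) <= a1 * W w1 (distr f1 l) + a2 * W w2 (distr f2 l)) ->
  (rho w f <= a1%:E * rho w1 f1 + a2%:E * rho w2 f2)%E.
Proof.
move=> hw hw1 hw2 a10 a20 h.
have [psi [psi0 psi_homo psiE]] := orlicz_inverse hphi.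
have lc v k (hv : weight_function v) :=
  layer_cake hphi psi0 psi_homo psiE hv (repr k).
have ml v k (hv : weight_function v) :=
  measurable_layer psi_homo hv (repr k).
have W0 v k (hv : weight_function v) s : 0 <= W v (distr k (psi s)).
  exact/(weight_primitive_ge0 hv)/distr_itv.
rewrite /modular !lc//; apply: ge0_integral_le_lincomb => //;
  try exact: ml; try by move=> s _; rewrite lee_fin W0.
by move=> s _; rewrite -!EFinM -EFinD lee_fin; exact: h.
Qed.

Lemma modular_le1 w w1 f f1 (a : R) : weight_function w ->
  weight_function w1 -> 0 <= a ->
  (forall l, 0 <= l -> W w (distr f l) <= a * W w1 (distr f1 l)) ->
  (rho w f <= a%:E * rho w1 f1)%E.
Proof.
move=> hw hw1 a0 h; have := @modular_le w w1 w1 f f1 f1 a 0 hw hw1 hw1.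
rewrite mul0e adde0; apply => // l l0; rewrite mul0r addr0; exact: h.
Qed.

Lemma modular_mean_le w f g : weight_function w ->
  (rho w (2^-1 *: (f + g)) <= rho w f + rho w g)%E.
Proof.
move=> hw.
have unscale (a b c : \bar R) : (c <= 1%:E * a + 1%:E * b -> c <= a + b)%E.
  by rewrite !mul1e.
have unscaleR (a b c : R) : c <= a + b -> c <= 1 * a + 1 * b.
  by rewrite !mul1r.
have H l : 0 <= l -> W w (distr (2^-1 *: (f + g)) l) <=
    1 * W w (distr f l) + 1 * W w (distr g l).
  move=> l0; apply: unscaleR; apply: (weight_primitive_subadditive hw).
  - exact: distr_itv.
  - exact: distr_itv.
  - exact: distr_itv.
  - exact: distr_mean_le.
apply: unscale.
exact: (modular_le hw hw hw ler01 ler01 H).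
Qed.

Lemma modular_scale_le w f (a b : R) : weight_function w -> 0 < a -> a <= b ->
  (rho w (a *: f) <= rho w (b *: f))%E.
Proof.
move=> hw a0 ab.
have unscale (x y : \bar R) : (x <= 1%:E * y -> x <= y)%E by rewrite mul1e.
apply/unscale/(modular_le1 hw hw ler01) => l l0.
have b0 : 0 < b by lra.
rewrite mul1r; apply: (weight_primitive_le hw).
- by case/andP: (distr_itv (a *: f) l).
- rewrite !distr_scale ?gt_eqF// !gtr0_norm//; apply: distr_nonincreasing.
  by rewrite ler_wpM2l// lef_pV2 ?posrE.
- by case/andP: (distr_itv (b *: f) l).
Qed.

(** Markov's inequality; the level l depends only on s and phi, which allows to
    let f vary by scaling. *)
Lemma modular_markov w (s : R) : weight_function w -> 0 <= s ->
  exists2 l, 0 <= l & forall f, ((s * W w (distr f l))%:E <= rho w f)%E.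
Proof.
move=> hw s0.
have [psi [psi0 psi_homo psiE]] := orlicz_inverse hphi.
exists (psi s) => // f.
rewrite /modular (layer_cake hphi psi0 psi_homo psiE hw (repr f)).
apply: (nonincreasing_integral_ge
  (h := fun t => W w (distr f (psi t))) _ _ s0).
  by move=> t; exact/(weight_primitive_ge0 hw)/distr_itv.
move=> t t' tt'; apply: (weight_primitive_le hw).
- by case/andP: (distr_itv f (psi t')).
- by apply: distr_nonincreasing; exact: psi_homo.
- by case/andP: (distr_itv f (psi t)).
Qed.

Lemma decreasing_rearrangement_scale a f t : 0 < a ->
  decreasing_rearrangement (L0_fun (a *: f)) t =
  (a%:E * decreasing_rearrangement (L0_fun f) t)%E.
Proof.
move=> a0; set x := LHS; set y := decreasing_rearrangement _ _.
have x0 : (0 <= x)%E := decreasing_rearrangement_ge0 (repr _) _.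
have y0 : (0 <= y)%E := decreasing_rearrangement_ge0 (repr _) _.
have xay l : 0 <= l -> (l%:E < x)%E = (l%:E < a%:E * y)%E.
  move=> l0; rewrite (lt_decreasing_rearrangement (repr _))//.
  rewrite -distrE distr_scale ?gt_eqF// gtr0_norm// distrE.
  rewrite -(lt_decreasing_rearrangement (repr _)) ?(divr_ge0 l0 (ltW a0))//.
  have -> : (l / a)%:E = (a^-1%:E * l%:E)%E by rewrite -EFinM mulrC.
  by rewrite lte_pdivrMl.
have ay0 : (0 <= a%:E * y)%E by rewrite mule_ge0// lee_fin ltW.
exact: ge0_ereal_eq_lt x0 ay0 xay.
Qed.

(** Applied with a <= 1, b = a and c = 0 (convexity) and with a = 2 (the Delta2
    condition).  The bound is pointwise in the rearrangement, which scales with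
    f; b must be positive because the rearrangement may be infinite. *)
Lemma modular_affine_bound w f (a b c : R) : weight_function w ->
  0 < a -> 0 < b -> 0 <= c ->
  (forall u, 0 <= u -> phi (a * u) <= b * phi u + c) ->
  (rho w (a *: f) <= b%:E * rho w f + (c * W w 1)%:E)%E.
Proof.
move=> hw a0 b0 c0 h; have b0' := ltW b0.
have [psi [psi0 psi_homo psiE]] := orlicz_inverse hphi.
have mm g := measurable_modular_integrand hphi psi0 psiE hw (repr g).
have w0 t : `]0%R, 1%R]%classic t -> (0 <= (w t)%:E)%E.
  by rewrite /= in_itv/= => t01; rewrite lee_fin ltW ?(weight_gt0 hw).
have G0 g t : (0 <= orlicz_ext phi (decreasing_rearrangement (L0_fun g) t))%E.
  apply: (orlicz_ext_ge0 hphi).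
  exact: (decreasing_rearrangement_ge0 (repr g)).
have mI : measurable (`]0, 1] : set cT) by exact: mitv.
have mw : measurable_fun (`]0, 1] : set cT) (EFin \o w).
  by apply/measurable_EFinP; exact: measurable_weight.
have -> : ((c * W w 1)%:E = c%:E * \int[m]_(t in `]0%R, 1%R]) (w t)%:E)%E.
  rewrite EFinM; congr (_ * _)%E.
  rewrite /weight_primitive fineK//; apply: integrable_fin_num => //.
  by apply: (weight_integrable hw).
apply: ge0_integral_le_lincomb;
  [by []|by []|by []|exact: mm|exact: mm|by []| | |exact: w0|].
- by move=> t t01; rewrite mule_ge0// w0.
- by move=> t t01; rewrite mule_ge0// w0.
move=> t t01; rewrite decreasing_rearrangement_scale// muleA.
rewrite -ge0_muleDl; last 2 first.
- by rewrite mule_ge0.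
- by [].
apply: lee_wpmul2r; first exact: w0.
have := decreasing_rearrangement_ge0 (repr f) t.
rewrite -/(L0_fun f); case: decreasing_rearrangement => [u|_|//] /=.
  by rewrite lee_fin => u0; rewrite -!EFinM -EFinD /= lee_fin; exact: h.
by rewrite !gt0_muley ?lte_fin//= addye.
Qed.

Lemma orlicz_lorentz_bounded w f M : weight_function w -> 0 <= M ->
  distr f M = 0 -> X w f.
Proof.
move=> hw M0 dM; exists 1; split; first lra.
rewrite scale1r.
apply: (@le_lt_trans _ _ (phi M * W w 1)%:E); last by rewrite ltry.
have iw : m.-integrable `]0, 1] (EFin \o w) by exact: (weight_integrable hw).
have mI : measurable (`]0, 1] : set cT) by exact: caratheodory_measurable_itv.
have [psi [psi0 psi_homo psiE]] := orlicz_inverse hphi.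
have -> : ((phi M * W w 1)%:E =
    (phi M)%:E * \int[m]_(t in `]0%R, 1%R]) (w t)%:E +
    0%:E * \int[m]_(t in `]0%R, 1%R]) (w t)%:E)%E.
  rewrite mul0e adde0 EFinM; congr (_ * _)%E.
  by rewrite /weight_primitive fineK//; apply: integrable_fin_num.
have w0 t : `]0%R, 1%R]%classic t -> (0 <= (w t)%:E)%E.
  by rewrite /= in_itv/= => t01; rewrite lee_fin ltW ?(weight_gt0 hw).
have mw : measurable_fun (`]0, 1] : set cT) (EFin \o w).
  by apply/measurable_EFinP; exact: measurable_weight.
have pM : 0 <= phi M by exact: orlicz_ge0.
apply: ge0_integral_le_lincomb;
  [exact: mI|exact: pM|by []| |exact: mw|exact: mw| |exact: w0|exact: w0|].
- exact: (measurable_modular_integrand hphi psi0 psiE hw (repr f)).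
- move=> t t01; apply: mule_ge0; last exact: w0.
  exact/(orlicz_ext_ge0 hphi)/(decreasing_rearrangement_ge0 (repr f)).
move=> t t01; rewrite mul0e adde0; apply: lee_wpmul2r; first exact: w0.
have : ~ (M%:E < decreasing_rearrangement (L0_fun f) t)%E.
  rewrite (lt_decreasing_rearrangement (repr f))//.
  rewrite -[distribution_function _ _]distrE dM.
  by move: t01; rewrite /= in_itv/= lte_fin; lra.
have := decreasing_rearrangement_ge0 (repr f) t; rewrite -/(L0_fun f).
case: decreasing_rearrangement => [u|_|//] /=; last by rewrite ltry.
rewrite !lee_fin lte_fin => u0 /negP; rewrite -leNgt.
exact: orlicz_nondecreasing.
Qed.

End modular.

(** * The Luxemburg norm *)

(* From here on these three are handled only through the lemmas above;
   unfolding them would make conversion compare integrals. *)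
Opaque modular distr weight_primitive.

Section norm.
Variables (R : realType) (phi : R -> R).
Hypothesis hphi : orlicz_function phi.
Local Notation rho := (modular phi).
Local Notation W := weight_primitive.
Local Notation X := (orlicz_lorentz phi).
Local Notation norm := (luxemburg_norm phi).
Implicit Types (f g : L0 R) (w : R -> R).

Lemma modular_contract w f (a : R) : weight_function w -> 0 < a <= 1 ->
  (rho w (a *: f) <= a%:E * rho w f)%E.
Proof.
move=> hw a01; have := @modular_affine_bound R phi hphi w f a a 0 hw.
rewrite mul0r adde0; apply; try lra.
by move=> u u0; rewrite addr0; apply: (orlicz_scale hphi); lra.
Qed.

Lemma luxemburg_norm_ge0 w f : 0 <= norm w f.
Proof.
rewrite /luxemburg_norm; set A := (X in inf X).
have [->|/set0P A0] := eqVneq A set0; first by rewrite inf0.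
by apply: lb_le_inf => // e [/ltW].
Qed.

Lemma luxemburg_norm_le w f e : 0 < e -> (rho w (e^-1 *: f) <= 1)%E ->
  norm w f <= e.
Proof.
move=> e0 he; apply: ge_inf; last by split.
by exists 0 => x [/ltW].
Qed.

(** Membership in the space is essential: it makes the set of admissible
    constants nonempty, so that its infimum, the norm, is approached. *)
Lemma modular_le1_norm w f e : weight_function w -> X w f -> norm w f < e ->
  (rho w (e^-1 *: f) <= 1)%E.
Proof.
move=> hw [k [k0 kf]] fe.
have ne : [set e : R | 0 < e /\ (modular phi w (e^-1 *: f) <= 1)%E] !=set0.
  have := modular_ge0 hphi (k *: f) hw; move: kf.
  case E : (rho w (k *: f)) => [r|//|//] _; rewrite lee_fin => r0.
  have ri : 0 < (r + 1)^-1 <= 1 by rewrite invr_gt0 invf_le1; lra.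
  exists ((r + 1) / k); split; first by rewrite divr_gt0//; lra.
  rewrite invfM invrK -scalerA.
  apply: le_trans (modular_contract _ hw ri) _.
  by rewrite E -EFinM lee_fin mulrC ler_pdivrMr; lra.
have [e' [e'0 he'] e'e] := inf_lt ne fe.
have e0 := lt_trans e'0 e'e.
apply: le_trans he'; apply: modular_scale_le => //; first by rewrite invr_gt0.
by rewrite lef_pV2 ?posrE// ltW.
Qed.

(** If the norm were 0, all dilations of f would have modular at most 1, against
    Markov's inequality at the level l' that f exceeds on a set of positive
    measure. *)
Lemma luxemburg_norm_gt0 w f : weight_function w -> X w f -> f <> 0 ->
  0 < norm w f.
Proof.
move=> hw Xf /distr_gt0[l' l'0 dl'].
rewrite lt_neqAle luxemburg_norm_ge0 andbT eq_sym; apply/negP => /eqP n0.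
have dW : 0 < W w (distr f l').
  by apply: (weight_primitive_gt0 hw); rewrite dl' (andP (distr_itv f l')).2.
have gt1_div (x : R) : 0 < x -> 1 < 2 / x * x.
  by move=> x0; rewrite divfK ?gt_eqF// ltr1n.
have s0 : 0 <= 2 / W w (distr f l') by rewrite divr_ge0// ltW.
have [l l0 hl] := modular_markov hphi hw s0.
have ll' : l * (l' / (l + 1)) <= l'.
  by rewrite mulrA ler_pdivrMr ?ltr_wpDl// mulrC ler_pM2l// lerDl.
have e0 : 0 < l' / (l + 1) by rewrite divr_gt0// ltr_wpDl.
have := modular_le1_norm hw Xf; rewrite n0 => /(_ _ e0).
rewrite leNgt => /negP; apply; apply: lt_le_trans (hl _).
have le_distr :
    W w (distr f l') <= W w (distr ((l' / (l + 1))^-1 *: f) l).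
  apply: (weight_primitive_le hw).
  - by case/andP: (distr_itv f l').
  - rewrite distr_scale ?gt_eqF ?invr_gt0// gtr0_norm ?invr_gt0// invrK.
    exact: distr_nonincreasing.
  - by case/andP: (distr_itv ((l' / (l + 1))^-1 *: f) l).
rewrite lte_fin; apply: lt_le_trans (ler_wpM2l s0 le_distr).
exact: gt1_div.
Qed.

Lemma orlicz_lorentz_add w f g : weight_function w ->
  X w f -> X w g -> X w (f + g).
Proof.
move=> hw [k [k0 kf]] [l [l0 lg]]; pose a := Num.min k l.
have a0 : 0 < a by rewrite lt_min k0.
exists (2^-1 * a); split; first by rewrite mulr_gt0// invr_gt0.
rewrite -scalerA scalerDr.
apply: le_lt_trans (modular_mean_le hphi _ _ hw) _.
apply: lte_add_pinfty.
  by apply: le_lt_trans kf; apply: modular_scale_le => //; rewrite ge_min lexx.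
apply: le_lt_trans lg; apply: modular_scale_le => //.
by rewrite ge_min lexx orbT.
Qed.

(** From rho((f + g) / 2) <= rho(f) + rho(g); the constant 4 pays one factor 2
    for the mean and one for making each modular at most 1/2. *)
Lemma luxemburg_norm_quasi_triangle w f g e : weight_function w ->
  X w f -> X w g -> norm w f < e -> norm w g < e -> norm w (f + g) <= 4 * e.
Proof.
move=> hw Xf Xg fe ge; have e0 := le_lt_trans (luxemburg_norm_ge0 w f) fe.
apply: luxemburg_norm_le; first by rewrite mulr_gt0.
have -> : (4 * e)^-1 = 2^-1 * (2^-1 * e^-1) by rewrite -!invfM mulrA -natrM.
rewrite -scalerA scalerDr.
apply: le_trans (modular_mean_le hphi _ _ hw) _.
have h01 : 0 < (2^-1 : R) <= 1 by rewrite invr_gt0 ltr0n/= invf_le1 ?ler1n.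
have -> : (1 = 2^-1%:E * 1 + 2^-1%:E * 1 :> \bar R)%E.
  by rewrite !mule1 -EFinD -[2^-1]mul1r -splitr.
rewrite -!scalerA; apply: leeD; apply: le_trans (modular_contract _ hw h01) _;
  by apply: lee_wpmul2l; [rewrite lee_fin invr_ge0|exact: modular_le1_norm].
Qed.

(** Two functions rather than one, so that the comparison also applies to a
    function and its opposite. *)
Lemma luxemburg_norm_domination w1 w2 f1 f2 C : weight_function w1 ->
  weight_function w2 -> 1 <= C ->
  (forall l, 0 <= l -> W w2 (distr f2 l) <= C * W w1 (distr f1 l)) ->
  X w1 f1 -> X w2 f2 /\ norm w2 f2 <= C * norm w1 f1.
Proof.
move=> hw1 hw2 C1 h Xf.
have C0 : 0 < C := lt_le_trans ltr01 C1.
have le k : 0 < k -> (rho w2 (k *: f2) <= C%:E * rho w1 (k *: f1))%E.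
  move=> k0; apply: (modular_le1 hphi hw2 hw1 (ltW C0)) => l l0.
  by rewrite !distr_scale ?gt_eqF//; apply: h; rewrite divr_ge0.
split.
  have [k [k0 kf]] := Xf; exists k; split => //; apply: le_lt_trans (le _ k0) _.
  by rewrite lte_mul_pinfty// lee_fin ltW.
have e0 e : norm w1 f1 < e -> norm w2 f2 <= C * e.
  move=> fe; have e0 := le_lt_trans (luxemburg_norm_ge0 w1 f1) fe.
  apply: luxemburg_norm_le; first by rewrite mulr_gt0.
  have C01 : 0 < C^-1 <= 1 by rewrite invr_gt0 C0 /= invf_le1.
  rewrite invfM -scalerA; apply: le_trans (modular_contract _ hw2 C01) _.
  apply: (@le_trans _ _ (C^-1%:E * (C%:E * rho w1 (e^-1 *: f1)))%E).
    apply: lee_wpmul2l; first by rewrite lee_fin invr_ge0 ltW.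
    by apply: le; rewrite invr_gt0.
  rewrite muleA -EFinM mulVf ?gt_eqF// mul1e.
  exact: modular_le1_norm.
apply/ler_addgt0Pr => d d0.
have -> : C * norm w1 f1 + d = C * (norm w1 f1 + d / C).
  by rewrite mulrDr [C * (d / C)]mulrC divfK ?gt_eqF.
by apply: e0; rewrite ltrDl divr_gt0.
Qed.

Lemma orlicz_lorentz_opp w f : weight_function w -> X w f ->
  X w (- f) /\ norm w (- f) <= norm w f.
Proof.
move=> hw Xf; rewrite -[leRHS]mul1r.
apply: luxemburg_norm_domination => // l _.
by rewrite distr_opp mul1r.
Qed.

End norm.

(** * Disjoint sequences and vanishing ratio of the primitives *)

Section support.
Variable R : realType.
Local Notation m := (@completed_lebesgue_measure R).
Local Notation cT := (caratheodory_type (wlength (@idfun R))^*%mu).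

Lemma measureU_ae (A B : set cT) : measurable A -> measurable B ->
  (\forall t \ae m, B t -> ~ A t) -> (m A + m B <= m (A `|` B))%E.
Proof.
move=> mA mB AB; have -> : A `|` B = A `|` (B `\` A).
  apply/seteqP; split => t [|]; [by left| |by left|by case; right].
  by move=> Bt; have [|] := pselect (A t); [left|right].
rewrite measureU//; last 2 first.
  by apply: measurableD.
  by rewrite setDE setICA setICr setI0.
apply: leeD => //; apply: le_measure_ae => //; first exact: measurableD.
by apply: filterS AB => t h Bt; split => //; exact: h.
Qed.

(** Otherwise the supports of n of the functions would fill measure n d, more
    than the measure of [0, 1] for n large. *)
Lemma disjoint_small_support (f : nat -> L0 R) (d : R) :
  pairwise_disjoint f -> 0 < d -> exists n, distr (f n) 0 <= d.
Proof.
move=> disj d0; apply: contrapT => h.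
have {}h n : d < distr (f n) 0.
  by rewrite ltNge; apply/negP => fd; apply: h; exists n.
pose S n := [set t : cT | t \in `[0%R, 1%R] /\ 0 < `|L0_fun (f n) t|].
have mS n : measurable (S n) by exact: measurable_L0_superlevel.
pose U n := \big[setU/set0]_(i < n) S i.
have mU n : measurable (U n) by apply: bigsetU_measurable.
have US n t : U n t -> exists2 i, (i < n)%N & S i t.
  by rewrite /U -bigcup_mkord => -[i /= ? ?]; exists i.
have disjS n : \forall t \ae m, S n t -> ~ U n t.
  have : \forall t \ae m, forall i, (i < n)%N -> S n t -> ~ S i t.
    apply/ae_foralln => i.
    have [ni|ni] := ltnP i n; last by apply: aeW.
    have ij : n <> i by move=> E; rewrite E ltnn in ni.
    apply: filterS (disj _ _ ij) => t ht _ [t01 nt] [_ it].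
    have /= := ht t01; rewrite /Num.min; case: ifPn => _ E.
      by rewrite E ltxx in nt.
    by rewrite E ltxx in it.
  by apply: filterS => t ht St /US[i /ht]; apply.
have mU_ge n : ((n%:R * d)%:E <= m (U n))%E.
  elim: n => [|n IH]; first by rewrite mul0r.
  rewrite /U big_ord_recr/= -/(U n).
  apply: le_trans (measureU_ae (mU n) (mS n) (disjS n)).
  rewrite -natr1 mulrDl mul1r EFinD; apply: leeD => //.
  by rewrite -[leRHS]distrE lee_fin ltW.
have U1 n : (m (U n) <= 1)%E.
  apply: (@le_trans _ _ (m `[0, 1]%classic)).
    apply: le_measure; rewrite ?inE//.
      exact: caratheodory_measurable_itv.
    by move=> t /US[i _ []].
  rewrite -[X in (X <= _)%E]/(@lebesgue_measure R `[0, 1]%classic).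
  by rewrite lebesgue_measure_itv /= lte_fin ltr01 sube0.
have [n dn] : exists n : nat, d^-1 < n%:R.
  by exists (Num.bound d^-1); apply: archi_boundP; rewrite invr_ge0 ltW.
have := le_trans (mU_ge n) (U1 n); rewrite lee_fin -ler_pdivlMr// div1r.
by rewrite leNgt dn.
Qed.

End support.

Section limit_zero.
Variables (R : realType) (w1 w2 : R -> R).
Hypotheses (hw1 : weight_function w1) (hw2 : weight_function w2).
Local Notation W1 := (weight_primitive w1).
Local Notation W2 := (weight_primitive w2).

(** The product form makes sense at t = 0 as well, where a distribution function
    may take its values. *)
Lemma limit_zeroP :
  W2 t / W1 t @[t --> 0^'+] --> (0 : R) <->
  forall e, 0 < e -> exists2 d : R, 0 < d <= 1 &
    forall t, 0 <= t <= d -> W2 t <= e * W1 t.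
Proof.
split=> [/cvgrPdist_le h e e0|h].
  have [d /= d0 hd] := h _ e0.
  exists (Num.min 1 (d / 2)).
    by rewrite lt_min ltr01 divr_gt0//= ge_min lexx.
  move=> t /andP[]; rewrite le_eqVlt => /predU1P[<- _|t0 td].
    by rewrite !weight_primitive0 mulr0.
  have t1 : 0 < t <= 1 by rewrite t0/= (le_trans td)// ge_min lexx.
  have W10 := weight_primitive_gt0 hw1 t1.
  have /(hd _)/(_ t0) : ball (0 : R) d t.
    rewrite /ball/= sub0r normrN gtr0_norm//.
    by apply: le_lt_trans td _; rewrite gt_min; apply/orP; right; lra.
  rewrite sub0r normrN => /(le_trans (ler_norm _)).
  by move=> h'; rewrite -ler_pdivrMr.
apply/cvgrPdist_le => e e0; have [d /andP[d0 d1] hd] := h _ e0.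
exists d => //= t; rewrite /ball/= sub0r normrN => td t0.
rewrite gtr0_norm// in td.
have t1 : 0 < t <= 1 by rewrite t0/= ltW// (lt_le_trans td).
have W10 := weight_primitive_gt0 hw1 t1.
have W20 := weight_primitive_gt0 hw2 t1.
rewrite sub0r normrN (ger0_norm (ltW (divr_gt0 W20 W10))).
by rewrite ler_pdivrMr// hd// (ltW t0)/= ltW.
Qed.

Lemma limit_zero_domination :
  W2 t / W1 t @[t --> 0^'+] --> (0 : R) ->
  exists2 C, 1 <= C & forall t, 0 <= t <= 1 -> W2 t <= C * W1 t.
Proof.
move=> /limit_zeroP/(_ _ ltr01)[d d01 hd].
have W10 := weight_primitive_gt0 hw1 d01.
exists (Num.max 1 (W2 1 / W1 d)); first by rewrite le_max lexx.
move=> t t01; have Wt := weight_primitive_ge0 hw1 t01.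
have [td|dt] := leP t d.
  apply: le_trans (hd t _) _; first by case/andP: t01 => -> _.
  by apply: ler_wpM2r => //; rewrite le_max lexx.
apply: (@le_trans _ _ (W2 1)).
  by apply: (weight_primitive_le hw2); lra.
apply: (@le_trans _ _ (W2 1 / W1 d * W1 t)).
  have W21 : 0 < W2 1 by apply: (weight_primitive_gt0 hw2); rewrite ltr01 lexx.
  rewrite -mulrA ler_peMr ?(ltW W21)// mulrC ler_pdivlMr// mul1r.
  by apply: (weight_primitive_le hw1); lra.
by apply: ler_wpM2r => //; rewrite le_max lexx orbT.
Qed.

End limit_zero.

Section no_comparable.
Variables (R : realType) (phi w1 w2 : R -> R).
Hypotheses (hphi : orlicz_function phi) (hDelta2 : Delta2_infty phi).
Hypotheses (hw1 : weight_function w1) (hw2 : weight_function w2).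
Local Notation W1 := (weight_primitive w1).
Local Notation W2 := (weight_primitive w2).
Local Notation rho := (modular phi).
Local Notation X := (orlicz_lorentz phi).
Local Notation norm := (luxemburg_norm phi).

(** Iterate the Delta2 bound until a power of 2 exceeds k. *)
Lemma modular_Delta2_bounded (w : R -> R) (k : R) : weight_function w ->
  exists2 B : R, 0 <= B & forall c (f : L0 R), 0 < c <= k ->
    (rho w f <= 1)%E -> (rho w (c *: f) <= B%:E)%E.
Proof.
move=> hw; have [K [C [K0 C0 hKC]]] := Delta2_affine hphi hDelta2.
have W0 : 0 <= weight_primitive w 1.
  by apply: (weight_primitive_ge0 hw); rewrite lexx ler01.
have pow2 j : exists2 B : R, 0 <= B & forall f : L0 R,
    (rho w f <= 1)%E -> (rho w ((2 ^+ j) *: f) <= B%:E)%E.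
  elim: j => [|j [B B0 IH]].
    by exists 1 => [|f fB]; [exact: ler01|rewrite expr0 scale1r; exact: fB].
  exists (K * B + C * weight_primitive w 1).
    by rewrite addr_ge0// mulr_ge0// ltW.
  move=> f /IH fB; rewrite exprS -scalerA.
  have := modular_affine_bound hphi (2 ^+ j *: f) hw (ltr0Sn _ _) K0 C0 hKC.
  move=> /le_trans; apply; rewrite EFinD EFinM; apply: leeD; last exact: lexx.
  by apply: lee_wpmul2l fB; rewrite lee_fin ltW.
have [j kj] : exists j : nat, k <= 2 ^+ j.
  exists (Num.bound `|k|); apply: le_trans (ler_norm _) _.
  apply: le_trans (ltW (archi_boundP _)) _; first exact: normr_ge0.
  by rewrite -natrX ler_nat ltnW// ltn_expl.
have [B B0 hB] := pow2 j; exists B => // c f /andP[c0 ck] /hB; apply: le_trans.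
apply: (modular_scale_le hphi _ hw c0); exact: le_trans kj.
Qed.

(** The number 4 K is the ratio of the dilations 2 / N and 1 / (2 K N), where N
    is the second norm of f n: the latter brings the first modular below 1, the
    former is to bring the second modular below 1. *)
Lemma limit_zero_no_comparable (f : nat -> L0 R) (K : R) :
  W2 t / W1 t @[t --> 0^'+] --> (0 : R) ->
  (forall n, X w1 (f n) /\ X w2 (f n)) -> (forall n, f n <> 0) ->
  pairwise_disjoint f -> 0 < K ->
  ~ forall n, norm w1 (f n) <= K * norm w2 (f n).
Proof.
move=> /(limit_zeroP hw1 hw2) lim Xf f0 disj K0 h.
have [B B0 hB] := modular_Delta2_bounded (4 * K) hw1.
have B1 : 0 < (B + 1)^-1 by rewrite invr_gt0 ltr_wpDl.
have [d /andP[d0 d1] hd] := lim _ B1.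
have [n fnd] := disjoint_small_support disj d0.
have [X1f X2f] := Xf n.
have := luxemburg_norm_gt0 hphi hw2 X2f (f0 n).
have := h n; set N := norm w2 (f n) => nK N0.
have KN0 : 0 < K * N by rewrite mulr_gt0.
have r1 : (rho w1 ((2 * (K * N))^-1 *: f n) <= 1)%E.
  apply: (modular_le1_norm hphi hw1 X1f); apply: le_lt_trans nK _.
  by rewrite mulr_natl mulr2n ltrDl.
have r1' : (rho w1 ((N / 2)^-1 *: f n) <= B%:E)%E.
  have cE (x y : R) : 0 < x -> 0 < y -> (y / 2)^-1 = 4 * x * (2 * (x * y))^-1.
    by move=> x0 y0; field; rewrite !gt_eqF.
  rewrite (cE K N)// -scalerA; apply: hB; last exact: r1.
  by rewrite mulr_gt0//= lexx.
have r2 : (rho w2 ((N / 2)^-1 *: f n) <= 1)%E.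
  apply: (@le_trans _ _ ((B + 1)^-1%:E * B%:E)%E); last first.
    by rewrite lee_fin mulrC ler_pdivrMr ?mul1r ?lerDl ?ltr_wpDl.
  apply: (@le_trans _ _
    ((B + 1)^-1%:E * rho w1 ((N / 2)^-1 *: f n))%E); last first.
    by apply: lee_wpmul2l => //; rewrite lee_fin ltW.
  apply: (modular_le1 hphi hw2 hw1 (ltW B1)) => l l0; apply: hd.
  case/andP: (distr_itv ((N / 2)^-1 *: f n) l) => -> _ /=.
  apply: le_trans fnd; rewrite distr_scale ?gt_eqF ?invr_gt0 ?divr_gt0//.
  by apply: distr_nonincreasing; rewrite divr_ge0.
have N20 : 0 < N / 2 by rewrite divr_gt0.
have := luxemburg_norm_le N20 r2; rewrite -/N leNgt => /negP; apply.
by rewrite ltr_pdivrMr// mulr_natr mulr2n ltrDl.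
Qed.

End no_comparable.

(** * Sums of indicators of a geometrically shrinking chain of intervals *)

Section steps.
Local Open Scope quotient_scope.
Variables (R : realType) (s : nat -> R).
Local Notation m := (@completed_lebesgue_measure R).
Local Notation cT := (caratheodory_type (wlength (@idfun R))^*%mu).
Local Notation I01 := (`[0%R, 1%R]%classic : set R).
Hypothesis s_itv : forall n, 0 < s n <= 1.
Hypothesis s_half : forall n, s n.+1 <= s n / 2.

Let A n : set cT := `]s n.+1, s n]%classic.

Let mA n : measurable (A n). Proof. exact: caratheodory_measurable_itv. Qed.

Definition step_mfun n : {mfun cT >-> R} := mindic R (mA n).
Definition step n : L0 R := \pi_(L0 R) (step_mfun n).

Let sP n : 0 < s n. Proof. by case/andP: (s_itv n). Qed.

Lemma step_point_le i j : (i <= j)%N -> s j <= s i.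
Proof.
elim: j => [|j IH]; first by rewrite leqn0 => /eqP->.
rewrite leq_eqVlt ltnS => /predU1P[->//|/IH]; apply: le_trans.
by apply: le_trans (s_half j) _; rewrite ler_pdivrMr// ler_peMr ?ler1n// ltW.
Qed.

Lemma step_cells_disjoint i j t : A i t -> A j t -> i = j.
Proof.
have lt k l : (k < l)%N -> A k t -> A l t -> False.
  move=> kl; rewrite /A/= !in_itv/= => /andP[kt _] /andP[_ tl].
  by have := lt_le_trans kt tl; rewrite ltNge step_point_le.
by case: (ltngtP i j) => // ij Ai Aj; [case: (lt _ _ ij)|case: (lt _ _ ij)].
Qed.

Let g n (a : nat -> R) (t : R) : R := \sum_(i < n) a i * \1_(A i) t.

Let g_in n a i t : (i < n)%N -> A i t -> g n a t = a i.
Proof.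
move=> lin Ait; rewrite /g (bigD1 (Ordinal lin))//= big1 => [|j ji].
  by rewrite indicE mem_set// mulr1 addr0.
rewrite indicE memNset ?mulr0// => Ajt; move/eqP: ji; apply.
by apply/val_inj; exact: step_cells_disjoint Ajt Ait.
Qed.

Let g_out n a t : g n a t != 0 -> exists2 i, (i < n)%N & A i t.
Proof.
apply: contra_neqP => h; rewrite /g big1// => i _.
by rewrite indicE memNset ?mulr0// => Ait; apply: h; exists i.
Qed.

Let sumE n (a : nat -> R) :
  ae_eq m I01 (L0_fun (\sum_(i < n) a i *: step i)) (g n a).
Proof.
rewrite /g; elim: n => [|n IH].
  rewrite big_ord0; apply: filterS (@L0_fun0 R) => t h It.
  by rewrite h// big_ord0.
have H1 := L0_fun_add (\sum_(i < n) a i *: step i) (a n *: step n).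
have H2 := L0_fun_scale (a n) (step n).
have H3 := L0_fun_pi (step_mfun n).
rewrite big_ord_recr/=; near=> t.
move=> It; rewrite big_ord_recr/=.
have -> : L0_fun (\sum_(i < n) a i *: step i + a n *: step n) t =
  L0_fun (\sum_(i < n) a i *: step i) t + L0_fun (a n *: step n) t.
  by move: It; near: t.
congr (_ + _); first by move: It; near: t.
have -> : L0_fun (a n *: step n) t = a n * L0_fun (step n) t.
  by move: It; near: t.
by congr (_ * _); move: It; near: t.
Unshelve. all: by end_near. Qed.

Lemma step_sum_distr_ge n (a : nat -> R) i l : (i < n)%N -> l < `|a i| ->
  s i / 2 <= distr (\sum_(j < n) a j *: step j) l.
Proof.
move=> lin li; rewrite -lee_fin distrE.
apply: (@le_trans _ _ (m (A i))).
  rewrite /A completed_lebesgue_itvoc ?lee_fin ?step_point_le//.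
  by have := s_half i; lra.
apply: le_measure_ae; [exact: mA|exact: measurable_L0_superlevel|].
apply: filterS (sumE n a) => t ht At.
have t01 : t \in `[0, 1].
  move: At; rewrite /A/= !in_itv/= => /andP[st ts].
  rewrite ltW ?(lt_trans (sP i.+1))//= (le_trans ts)//.
  by case/andP: (s_itv i).
by split => //; rewrite ht// (g_in _ lin At).
Qed.

Lemma step_sum_distr_le n (a : nat -> R) b l : 0 <= l -> 0 <= b <= 1 ->
  (forall i, (i < n)%N -> l < `|a i| -> s i <= b) ->
  distr (\sum_(j < n) a j *: step j) l <= b.
Proof.
move=> l0 /andP[b0 b1] h; rewrite -lee_fin distrE.
apply: (@le_trans _ _ (m `]0, b]%classic)); last first.
  by rewrite completed_lebesgue_itvoc// subr0.
apply: le_measure_ae; first exact: measurable_L0_superlevel.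
  exact: caratheodory_measurable_itv.
apply: filterS (sumE n a) => t ht [t01]; rewrite ht// => lg.
have /g_out[i lin Ait] : g n a t != 0.
  by rewrite -normr_gt0; exact: le_lt_trans lg.
rewrite (g_in _ lin Ait) in lg; move: (Ait); rewrite /A/= !in_itv/=.
by move=> /andP[st ts]; rewrite (lt_trans _ st)//= (le_trans ts)// h.
Qed.

(** With [orlicz_lorentz_bounded] this places the combinations in both
    spaces. *)
Lemma step_sum_bounded n (a : nat -> R) : exists2 M,
  0 <= M & distr (\sum_(j < n) a j *: step j) M = 0.
Proof.
exists (\sum_(j < n) `|a j|); first by apply: sumr_ge0.
apply/eqP; rewrite eq_le (andP (distr_itv _ _)).1 andbT.
apply: step_sum_distr_le; rewrite ?sumr_ge0 ?lexx ?ler01// => i lin.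
rewrite ltNge => /negP[]; rewrite (bigD1 (Ordinal lin))//= lerDl.
exact: sumr_ge0.
Qed.

Lemma step_sum1 n : step n = \sum_(j < n.+1) (j == n :> nat)%:R *: step j.
Proof.
rewrite big_ord_recr/= eqxx scale1r big1 ?add0r// => i _.
by rewrite ltn_eqF ?scale0r.
Qed.

Lemma step_neq0 n : step n <> 0.
Proof.
move=> E; have := @step_sum_distr_ge n.+1 (fun j => (j == n)%:R) n 0.
rewrite -(step_sum1 n) E distr0// eqxx normr1 => /(_ (leqnn _) ltr01).
by rewrite leNgt divr_gt0.
Qed.

Lemma step_disjoint : pairwise_disjoint step.
Proof.
move=> i j ij.
apply: filterS2 (L0_fun_pi (step_mfun i)) (L0_fun_pi (step_mfun j)).
move=> t hi hj t01 /=.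
have -> : L0_fun (step i) t = \1_(A i) t by exact: hi.
have -> : L0_fun (step j) t = \1_(A j) t by exact: hj.
rewrite !indicE; have [Ai|Ai] := pselect (A i t).
  have Aj : ~ A j t by move=> Aj; apply: ij; exact: step_cells_disjoint Ai Aj.
  by rewrite (memNset Aj) normr0 min_r.
by rewrite (memNset Ai) normr0 min_l.
Qed.

(** For the first index i whose coefficient exceeds l in absolute value, the
    distribution function lies between s i / 2 and s i, and W2 (s i) is at most
    2 W2 (s i / 2). *)
Lemma step_sum_distr_comparison (w1 w2 : R -> R) (e : R) n (a : nat -> R) l :
  weight_function w1 -> weight_function w2 -> 0 < e ->
  (forall n, e * weight_primitive w1 (s n) <= weight_primitive w2 (s n)) ->
  0 <= l ->
  weight_primitive w1 (distr (\sum_(j < n) a j *: step j) l) <=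
  2 / e * weight_primitive w2 (distr (\sum_(j < n) a j *: step j) l).
Proof.
move=> hw1 hw2 e0 hs l0; set y := \sum_(j < n) _.
have [dy0 dy1] := andP (distr_itv y l).
have [[i /andP[lin li]]|h] :=
    pselect (exists i : nat, (i < n)%N && (l < `|a i|)); last first.
  have -> : distr y l = 0.
    apply/eqP; rewrite eq_le dy0 andbT.
    apply: step_sum_distr_le; rewrite ?lexx ?ler01// => i lin li.
    by exfalso; apply: h; exists i; rewrite lin.
  by rewrite !weight_primitive0 mulr0.
have ex : exists i : nat, (i < n)%N && (l < `|a i|) by exists i; rewrite lin.
case: (ex_minnP ex) => {lin li}i /andP[lin li] imin.
have [si0 si1] := andP (s_itv i).
have dyle : distr y l <= s i.
  apply: step_sum_distr_le => //; first by rewrite ltW.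
  by move=> j jn lj; apply: step_point_le; apply: imin; rewrite jn.
have dyge : s i / 2 <= distr y l by exact: step_sum_distr_ge lin li.
have h0 : 0 <= s i / 2 by rewrite divr_ge0 ?ltW.
apply: (@le_trans _ _ (weight_primitive w1 (s i))).
  exact: (weight_primitive_le hw1).
rewrite mulrAC ler_pdivlMr// mulrC; apply: le_trans (hs i) _.
apply: (@le_trans _ _ (2 * weight_primitive w2 (s i / 2))); last first.
  by rewrite ler_pM2l//; apply: (weight_primitive_le hw2).
rewrite mulr_natl mulr2n; apply: (weight_primitive_subadditive hw2).
- by rewrite h0 (le_trans dyge).
- by rewrite h0 (le_trans dyge).
- by rewrite ltW.
- by rewrite -splitr.
Qed.

End steps.

(** * Comparison of the norms on a closed span *)

Section converse.
Variables (R : realType) (phi w1 w2 : R -> R).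
Hypothesis hphi : orlicz_function phi.
Hypotheses (hw1 : weight_function w1) (hw2 : weight_function w2).
Local Notation W1 := (weight_primitive w1).
Local Notation W2 := (weight_primitive w2).
Local Notation X := (orlicz_lorentz phi).
Local Notation norm := (luxemburg_norm phi).

(** Choose a point where the ratio exceeds e below 1, then again and again below
    half of the previous one. *)
Lemma not_limit_zero_points :
  ~ (W2 t / W1 t @[t --> 0^'+] --> (0 : R)) ->
  exists (e : R) (s : nat -> R), [/\ 0 < e, forall n, 0 < s n <= 1,
    forall n, s n.+1 <= s n / 2 & forall n, e * W1 (s n) <= W2 (s n)].
Proof.
move=> nlim; apply: contrapT => h; apply: nlim.
apply/(limit_zeroP hw1 hw2) => e e0; apply: contrapT => hd; apply: h.
have pickE (d : R) : exists t, 0 < d <= 1 -> 0 < t <= d /\ e * W1 t <= W2 t.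
  have [d01|nd] := pselect (0 < d <= 1); last by exists 0 => /nd.
  have [[t [t0d /ltW tW]]|nt] :=
      pselect (exists t, 0 < t <= d /\ e * W1 t < W2 t); first by exists t.
  exfalso; apply: hd; exists d => // t /andP[].
  rewrite le_eqVlt => /predU1P[<- _|t0 td].
    by rewrite !weight_primitive0 mulr0.
  by rewrite leNgt; apply/negP => tW; apply: nt; exists t; rewrite t0.
have [pick pickP] := choice pickE.
pose s n := iter n (fun t => pick (t / 2)) (pick 1).
have sS n : s n.+1 = pick (s n / 2) by [].
have half (x : R) : 0 < x <= 1 -> 0 < x / 2 <= 1.
  move=> /andP[x0 x1]; rewrite divr_gt0//= ler_pdivrMr// mul1r.
  by rewrite (le_trans x1)// ler1n.
have sP n : 0 < s n <= 1 /\ e * W1 (s n) <= W2 (s n).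
  elim: n => [|n [sn IH]]; first by apply: pickP; rewrite ltr01 lexx.
  have [/andP[p0 p1] pW] := pickP _ (half _ sn).
  by rewrite sS p0 (le_trans p1) //; have /andP[] := half _ sn.
exists e, s; split => // n; [by case: (sP n)| |by case: (sP n)].
by rewrite sS; have [/andP[]] := pickP _ (half _ (sP n).1).
Qed.

(** Approximate y by a combination s of the x i within e in the first norm; then
    ||y||_1 <= 4 (||s||_1 + e), ||s||_1 <= C ||s||_2 and
    ||s||_2 <= 4 (||y||_2 + (|C'| + 1) e), and e is arbitrary. *)
Lemma span_domination (C C' : R) (x : nat -> L0 R) (y : L0 R) : 1 <= C ->
  (forall n (a : nat -> R), X w1 (\sum_(i < n) a i *: x i)) ->
  (forall n (a : nat -> R) l, 0 <= l ->
    W1 (distr (\sum_(i < n) a i *: x i) l) <=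
    C * W2 (distr (\sum_(i < n) a i *: x i) l)) ->
  (forall f, X w1 f -> X w2 f) ->
  (forall f, X w1 f -> norm w2 f <= C' * norm w1 f) ->
  closed_span (X w1) x y -> norm w1 y <= 16 * C * norm w2 y.
Proof.
move=> C1 Xs hs X12 hC' [X1y hy].
have C0 : 0 < C := lt_le_trans ltr01 C1.
pose C'' := `|C'| + 1; have C''0 : 0 < C'' by rewrite ltr_wpDl.
have := luxemburg_norm_ge0 phi w2 y.
have [a aE] : exists a, norm w2 y = a by exists (norm w2 y).
rewrite aE => a0.
have main e : 0 < e -> norm w1 y <= 4 * (C * (4 * (a + C'' * e)) + e).
  move=> e0; have [n [c]] := hy _ e0; rewrite [nrm _ _]/=.
  have := Xs n c; have := hs n c.
  move: (\sum_(i < n) c i *: x i) => s hsc X1s nys.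
  have [X1s' _] := orlicz_lorentz_opp hphi hw1 X1s.
  have X1ys : X w1 (y - s) := orlicz_lorentz_add hphi hw1 X1y X1s'.
  have X2ys := X12 _ X1ys.
  have [X2sy] := orlicz_lorentz_opp hphi hw2 X2ys; rewrite opprB => nsy.
  rewrite opprB in X2sy.
  have Ce : norm w2 (s - y) < C'' * e.
    apply: le_lt_trans nsy _; apply: le_lt_trans (hC' _ X1ys) _.
    apply: (@le_lt_trans _ _ (`|C'| * norm w1 (y - s))).
      by apply: ler_wpM2r (ler_norm _); exact: luxemburg_norm_ge0.
    apply: (@le_lt_trans _ _ (`|C'| * e)).
      by apply: ler_wpM2l; rewrite ?normr_ge0// ltW.
    by rewrite ltr_pM2r// ltrDl.
  have Ce0 : 0 < C'' * e by rewrite mulr_gt0.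
  have alt : a < a + C'' * e by rewrite ltrDl.
  have Cle : C'' * e <= a + C'' * e by rewrite lerDr.
  have n2s : norm w2 s <= 4 * (a + C'' * e).
    rewrite -(subrKC y s).
    apply: (luxemburg_norm_quasi_triangle hphi hw2 (X12 _ X1y) X2sy).
      by rewrite aE; exact: alt.
    exact: lt_le_trans Ce Cle.
  have [_ n1s] := luxemburg_norm_domination hphi hw2 hw1 C1 hsc (X12 _ X1s).
  have CC0 : 0 <= C * (4 * (a + C'' * e)).
    by rewrite mulr_ge0 ?(ltW C0)// mulr_ge0// addr_ge0// ltW.
  have CClt : C * (4 * (a + C'' * e)) < C * (4 * (a + C'' * e)) + e.
    by rewrite ltrDl.
  have ele : e <= C * (4 * (a + C'' * e)) + e by rewrite lerDr.
  rewrite -(subrKC s y).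
  apply: (luxemburg_norm_quasi_triangle hphi hw1 X1s X1ys).
    apply: le_lt_trans CClt; apply: le_trans n1s _.
    by apply: ler_wpM2l n2s; exact: ltW.
  exact: lt_le_trans nys ele.
have lin (b e : R) : 4 * (C * (4 * (b + C'' * e)) + e) =
    16 * C * b + (16 * C * C'' + 4) * e by ring.
apply/ler_addgt0Pr => d d0.
have D0 : 0 < 16 * C * C'' + 4 by rewrite addr_gt0// !mulr_gt0.
have := main (d / (16 * C * C'' + 4)) (divr_gt0 d0 D0).
by rewrite lin [X in _ + X]mulrC divfK ?gt_eqF.
Qed.

Lemma closed_span_generator (x : nat -> L0 R) n :
  X w1 (x n) -> closed_span (X w1) x (x n).
Proof.
move=> Xn; split => // e e0; exists n.+1, (fun i => (i == n)%:R).
rewrite big_ord_recr/= eqxx scale1r big1 ?add0r ?subrr => [|i _]; last first.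
  by rewrite ltn_eqF ?scale0r.
apply: le_lt_trans e0; apply/ler_addgt0Pr => d d0; rewrite add0r.
apply: luxemburg_norm_le => //.
have dist0 l : 0 <= l ->
    W1 (distr (d^-1 *: 0) l) <= 0 * W1 (distr (0 : L0 R) l).
  by move=> l0; rewrite scaler0 distr0// weight_primitive0 mul0r.
apply: le_trans (modular_le1 hphi hw1 hw1 (lexx 0) dist0) _.
by rewrite mul0e lee_fin.
Qed.

End converse.

Theorem theorem3p4 (R : realType) (phi w1 w2 : R -> R)
    (hphi : orlicz_function phi) (hDelta2 : Delta2_infty phi)
    (hw1 : weight_function w1) (hw2 : weight_function w2) :
  let W1 := weight_primitive w1 in
  let W2 := weight_primitive w2 in
  let X1 := orlicz_lorentz phi w1 in
  let X2 := orlicz_lorentz phi w2 in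
  let limit_zero := W2 t / W1 t @[t --> 0^'+] --> (0 : R) in
  let inclusion_DSS :=
    disjointly_strictly_singular X1 X2 (fun f : L0 R => f) in
  let no_comparable_sequence :=
    ~ exists (f : nat -> L0 R) (K : R),
        [/\ forall n, X1 (f n) /\ X2 (f n),
            forall n, f n <> 0,
            pairwise_disjoint f,
            0 < K &
            forall n, nrm X1 (f n) <= K * nrm X2 (f n)] in
  (limit_zero <-> inclusion_DSS) /\ (inclusion_DSS <-> no_comparable_sequence).
Proof.
move=> W1 W2 X1 X2 limit_zero DSS no_seq.
have lim_no_seq : limit_zero -> no_seq.
  move=> lim [f [K [Xf f0 disj K0 h]]].
  exact: (limit_zero_no_comparable hphi hDelta2 hw1 hw2 lim Xf f0 disj K0 h).
have lim_DSS : limit_zero -> DSS.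
  move=> lim; have [C C1 hC] := limit_zero_domination hw1 hw2 lim.
  have dom f : X1 f -> X2 f /\ nrm X2 f <= C * nrm X1 f.
    apply: (luxemburg_norm_domination hphi hw1 hw2 C1) => l l0.
    exact/hC/distr_itv.
  split.
    split.
    - by move=> f /dom[fX _]; exact: fX.
    - by move=> a f g _ _; reflexivity.
    - by exists C => f /dom[_ fle]; exact: fle.
  move=> x X1x x0 disj [_ [S [SK [_ _ [K hK]]]]].
  apply: (lim_no_seq lim); exists x, (`|K| + 1).
  have K1 : 0 < `|K| + 1 by rewrite ltr_wpDl.
  split; [|exact: x0|exact: disj|exact: K1|] => n.
    by split; [exact: X1x|have [X2x _] := dom _ (X1x n)].
  have Xn : sub_normed X1 (closed_span X1 x) (x n).
    by split; [exact: X1x|exact: closed_span_generator].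
  have KK1 : K <= `|K| + 1 by apply: le_trans (ler_norm K) _; rewrite lerDl.
  have [X2x _] := dom _ (X1x n).
  have := hK (x n) (conj X2x (ex_intro2 _ _ (x n) Xn erefl)).
  rewrite (SK _ Xn) => /le_trans; apply.
  exact: (ler_wpM2r (luxemburg_norm_ge0 phi w2 (x n)) KK1).
(* one sequence refutes both of the other properties *)
have bad : ~ limit_zero -> exists (x : nat -> L0 R) (C : R), [/\ 1 <= C,
    forall n, x n <> 0, pairwise_disjoint x,
    forall w, weight_function w -> forall n (a : nat -> R),
      orlicz_lorentz phi w (\sum_(i < n) a i *: x i) &
    (forall n, exists a : nat -> R, x n = \sum_(i < n.+1) a i *: x i) /\
    forall n (a : nat -> R) l, 0 <= l ->
      W1 (distr (\sum_(i < n) a i *: x i) l) <=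
      C * W2 (distr (\sum_(i < n) a i *: x i) l)].
  move=> /(not_limit_zero_points hw1 hw2)[e [s [e0 s01 s_half sW]]].
  exists (step s), (Num.max 1 (2 / e)); split.
  - by rewrite le_max lexx.
  - exact: step_neq0.
  - exact: step_disjoint.
  - move=> w hw n a; have [M M0 dM] := step_sum_bounded s01 s_half n a.
    exact: (orlicz_lorentz_bounded hphi hw M0 dM).
  split; first by move=> n; exists (fun j => (j == n)%:R); exact: step_sum1.
  move=> n a l l0.
  apply: le_trans (step_sum_distr_comparison s01 s_half n a hw1 hw2 e0 sW l0) _.
  apply: ler_wpM2r; last by rewrite le_max lexx orbT.
  exact/(weight_primitive_ge0 hw2)/distr_itv.
have no_seq_lim : no_seq -> limit_zero.
  move=> no; apply: contrapT => /bad[x [C [C1 x0 disj Xs [xs hs]]]]; apply: no.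
  exists x, C; split.
  - by move=> n; have [a ->] := xs n; split; exact: Xs.
  - exact: x0.
  - exact: disj.
  - exact: lt_le_trans ltr01 C1.
  - move=> n; have [a ->] := xs n.
    have [_ dom] := luxemburg_norm_domination hphi hw2 hw1 C1
      (hs n.+1 a) (Xs w2 hw2 n.+1 a).
    exact: dom.
have DSS_lim : DSS -> limit_zero.
  move=> [[J12 _ [C' hC']] hDSS]; apply: contrapT.
  move=> /bad[x [C [C1 x0 disj Xs [xs hs]]]].
  apply: (hDSS x); [|exact: x0|exact: disj|].
    by move=> n; have [a ->] := xs n; exact: Xs.
  split.
    split.
    - by move=> f [X1f _]; exact: J12.
    - by move=> a f g _ _; reflexivity.
    - by exists C' => f [X1f _]; exact: hC'.
  exists id; split; first by move=> f _; reflexivity.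
  split.
  - by move=> f [_ [g Xg <-]]; exact: Xg.
  - by move=> a f g _ _; reflexivity.
  exists (16 * C) => f [_ [g [_ spang] <-]].
  exact: (span_domination hphi hw1 hw2 C1 (Xs _ hw1) hs J12 hC' spang).
split; split; [exact: lim_DSS|exact: DSS_lim| |].
- by move=> /DSS_lim/lim_no_seq.
- by move=> /no_seq_lim/lim_DSS.
Qed.
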